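(* For each of the following square-tiled translation surfaces (the translation covers of the compact quotients of Mucube, Muoctahedron, Mutetrahedron, Octa-4, and Truncated Octa-8, as specified in the context), the index of the Veech group $\Gamma$ in $SL(2,\mathbb{Z})$, a complete set of representatives of the cusps of $\Gamma$, and the cusp widths (listed in the same order as the cusps) are as follows. \begin{itemize} \item Mucube: index $9$; cusps $\{\infty, 1/2, 1\}$; widths $\{4,2,3\}$. \item Muoctahedron: index $16$; cusps $\{\infty, 1/5, 1/2, 1/7\}$; widths $\{9,1,3,3\}$. \item Mutetrahedron: index $4$; cusps $\{\infty, 1\}$; widths $\{3,1\}$. \item Octa-4: index $4$; cusps $\{\infty, 1/2\}$; widths $\{3,1\}$. \item Truncated Octa-8: index $15$; cusps $\{\infty, 3, 1, 4\}$; widths $\{6,2,3,4\}$. \end{itemize}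
   Context: Square-tiled surfaces. A pair $(\sigma_h,\sigma_v)$ of permutations of $\{1,\dots,N\}$ generating a transitive group defines a translation surface from $N$ unit squares: the right side of square $i$ is glued by translation to the left side of square $\sigma_h(i)$, and the top of square $i$ is glued to the bottom of square $\sigma_v(i)$. Veech group. $SL(2,\mathbb{R})$ acts on translation surfaces $(X,\omega)$ by $\mathbb{R}$-linear post-composition with the translation charts to $\mathbb{C}=\mathbb{R}^2$; the Veech group $SL(X,\omega)$ is the stabilizer of $(X,\omega)$. For the surfaces below it is a finite index subgroup $\Gamma$ of $SL(2,\mathbb{Z})$. Cusps of $\Gamma$ are the $\Gamma$-orbits on $\mathbb{Q}\cup\{\infty\}$ under M\''obius transformations. The width of a cusp $c$ is the smallest $w>0$ with $\begin{pmatrix}1&w\\0&1\end{pmatrix}\in\gamma^{-1}\Gamma\gamma$, where $\gamma\in SL(2,\mathbb{Z})$ satisfies $\gamma(\infty)=c$. The surfaces. Mucube $\{4,6\}$, Muoctahedron $\{6,4\}$, Mutetrahedron $\{6,6\}$, Octa-4 $\{3,8\}$, Truncated Octa-8 $\{4,5\}$ are triply periodic polyhedral surfaces in $\mathbb{R}^3$ tiled by regular $p$-gons, $q$ at each vertex (type $\{p,q\}$); each compact quotient by its period lattice carries a flat metric given by a $k$-differential, and its translation cover is the $k$-fold branched cover on which the rotational holonomy becomes trivial ($k=2,3,2,3,4$ respectively). For surfaces tiled by triangles or hexagons (hexagons being subdivided into six triangles), triangles are paired into rhombi and the linear map $\begin{pmatrix}1&1/2\\0&\sqrt3/2\end{pmatrix}^{-1}$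 is applied to obtain a square-tiled surface. The resulting translation covers are the square-tiled surfaces given by the following permutations. Mucube (24 squares): $\sigma_h=(1,2,3,4)(5,6,7,8)(9,10,11,12)(13,14,15,16)(17,18,19,20)(21,22,23,24)$, $\sigma_v=(1,9,14,22)(2,20,13,7)(3,24,16,11)(4,5,15,18)(6,10,17,21)(8,23,19,12)$. Muoctahedron (72 squares): $\sigma_h=(1,2,3,4,5,6,7,8,9)(10,11,12,13,14,15,16,17,18)(19,20,21,22,23,24,25,26,27)(28,29,30,31,32,33,34,35,36)(37,38,39,40,41,42,43,44,45)(46,47,48,49,50,51,52,53,54)(55,56,57,58,59,60,61,62,63)(64,65,66,67,68,69,70,71,72)$, $\sigma_v=(1,10,3,37,54,39,36,20,29)(2,11,19,28,21,53,38,46,18)(4,16,6,33,23,35,58,70,60)(5,17,69,59,71,22,34,24,15)(7,13,9,55,64,57,40,51,42)(8,14,50,41,52,72,56,65,12)(25,31,27,66,62,68,47,44,49)(26,32,43,48,45,61,67,63,30)$. Mutetrahedron (24 squares): $\sigma_h=(1,2,3,4,5,6)(7,8,9,10,11,12)(13,14,15,16,17,18)(19,20,21,22,23,24)$, $\sigma_v=(1,7,13,11,3,21)(2,20,14,12,18,22)(4,10,16,8,6,24)(5,23,17,9,15,19)$. Octa-4 (48 squares): $\sigma_h=(1,2,3)(4,5,6)(7,8,9)(10,11,12)(13,14,15)(16,17,18)(19,20,21)(22,23,24)(25,26,27)(28,29,30)(31,32,33)(34,35,36)(37,38,39)(40,41,42)(43,44,45)(46,47,48)$, $\sigma_v=(1,6,35)(2,32,41)(3,48,7)(4,9,10)(5,38,20)(8,17,26)(11,25,30)(12,43,39)(13,18,47)(14,44,29)(15,36,19)(16,21,22)(23,37,42)(24,31,27)(28,33,34)(40,45,46)$.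 Truncated Octa-8 (120 squares): $\sigma_h$ is the product of the twenty 6-cycles $(6j+1,6j+2,6j+3,6j+4,6j+5,6j+6)$, $0\le j\le 19$, and $\sigma_v=(1,34,75,81,120,7)(2,20,111,80,62,25)(3,40,67,79,107,15)(4,10,117,84,78,31)(5,28,65,83,114,23)(6,18,104,82,70,37)(8,52,71,74,96,17)(9,24,86,73,64,43)(11,14,93,77,68,49)(12,46,61,76,89,21)(13,22,99,69,66,55)(16,58,63,72,102,19)(26,45,115,110,90,33)(27,38,98,109,103,56)(29,36,87,113,118,48)(30,59,106,112,101,41)(32,92,108,116,50,39)(35,42,53,119,105,95)(44,57,91,85,97,51)(47,54,100,88,94,60)$. *)

(* Defs.v *)
From HB Require Import structures.
From Stdlib Require List.
From Stdlib Require Import Relation_Operators.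
From mathcomp Require Import all_boot all_order all_fingroup all_algebra.
From mathcomp Require Import generic_quotient.
From mathcomp Require Import all_classical all_reals all_analysis.

Set Implicit Arguments.
Unset Strict Implicit.
Unset Printing Implicit Defensive.

Import Order.TTheory GRing.Theory Num.Theory.
Import numFieldNormedType.Exports.

Local Open Scope classical_set_scope.
Local Open Scope card_scope.
Local Open Scope ring_scope.

(** A translation surface is presented by its underlying space, with the cone
    points included, and by its maximal translation atlas: [chart U phi] says
    that [phi], restricted to the open set [U], is a translation chart.  Values
    of [phi] outside [U] are irrelevant.  The cone points (zeros of the
    1-form) are the points that lie in the domain of no chart. *)
Record tsurface (R : realType) := TSurface {
  points : topologicalType;
  chart : set points -> (points -> 'cV[R]_2) -> Prop
}.

Definition SL2R (R : realType) : set 'M[R]_2 := [set A | \det A = 1].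

Definition sl_act (R : realType) (A : 'M[R]_2) (X : tsurface R) : tsurface R :=
  @TSurface R (points X)
    (fun U psi => exists2 phi, chart U phi & psi = (fun x => A *m phi x)).

(** Since the atlases are maximal, an isomorphism carries one atlas exactly
    onto the other. *)
Definition tsurface_iso (R : realType) (X Y : tsurface R) : Prop :=
  exists (f : points X -> points Y) (g : points Y -> points X),
    [/\ cancel f g, cancel g f, continuous f, continuous g &
        forall (U : set (points Y)) (phi : points Y -> 'cV[R]_2),
          chart U phi <-> chart (f @^-1` U) (phi \o f)].

Definition veech_group (R : realType) (X : tsurface R) : set 'M[R]_2 :=
  [set A | SL2R A /\ tsurface_iso (sl_act A X) X].

Section SquareTiled.
Variables (R : realType) (N : nat) (sh sv : {perm 'I_N}).

Definition unit_square : set 'cV[R]_2 := [set p | forall k, 0 <= p k 0 <= 1].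

Definition squares : Type := {i : 'I_N & set_type unit_square}.

Inductive glued : squares -> squares -> Prop :=
| glued_right i (p q : set_type unit_square) :
    set_val p 0 0 = 1 -> set_val q 0 0 = 0 ->
    set_val p 1 0 = set_val q 1 0 ->
    glued (existT _ i p) (existT _ (sh i) q)
| glued_top i (p q : set_type unit_square) :
    set_val p 1 0 = 1 -> set_val q 1 0 = 0 ->
    set_val p 0 0 = set_val q 0 0 ->
    glued (existT _ i p) (existT _ (sv i) q).

Definition glue_rel (a b : squares) : bool :=
  `[< clos_refl_sym_trans squares glued a b >].

Lemma glue_rel_refl : reflexive glue_rel.
Proof. by move=> a; apply/asboolP; exact: rst_refl. Qed.

Lemma glue_rel_sym : symmetric glue_rel.
Proof.
by move=> a b; apply/asboolP/asboolP => h; exact: rst_sym.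
Qed.

Lemma glue_rel_trans : transitive glue_rel.
Proof.
move=> b a c /asboolP ab /asboolP bc; apply/asboolP; exact: rst_trans ab bc.
Qed.

Canonical glue_equiv :=
  EquivRel glue_rel glue_rel_refl glue_rel_sym glue_rel_trans.

Definition glued_space : topologicalType :=
  quotient_topology {eq_quot glue_equiv}%qT.

Definition square_map (i : 'I_N) (p : set_type unit_square) : glued_space :=
  (\pi_{eq_quot glue_equiv} (existT _ i p : squares))%qT.

(** [phi] is a homeomorphism from the open set [U] onto an open subset of the
    plane and is locally a translation in the coordinates of every square.  A
    vertex with cone angle 2 pi m has such a chart if and only if m = 1, so
    that vertices of cone angle 2 pi are regular points. *)
Definition square_chart (U : set glued_space) (phi : glued_space -> 'cV[R]_2)
    : Prop :=
  [/\ open U,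
      set_inj U phi,
      forall x, U x -> {for x, continuous phi},
      forall V : set glued_space, open V -> V `<=` U -> open (phi @` V) &
      forall i (p : set_type unit_square), U (square_map i p) ->
        \forall q \near p,
          phi (square_map i q) - set_val q =
          phi (square_map i p) - set_val p].

Definition square_tiled : tsurface R :=
  @TSurface R glued_space square_chart.

End SquareTiled.

Definition SL2Z : set 'M[int]_2 := [set A | \det A = 1].

Definition intmx (R : realType) (A : 'M[int]_2) : 'M[R]_2 :=
  map_mx intr A.

Definition veech_groupZ (R : realType) (X : tsurface R) : set 'M[int]_2 :=
  [set A | veech_group X (intmx R A)].

Definition left_cosets (G H : set 'M[int]_2) : set (set 'M[int]_2) :=
  [set [set g *m h | h in H] | g in G].

Definition has_index (G H : set 'M[int]_2) (n : nat) : Prop :=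
  H `<=` G /\ left_cosets G H #= `I_n.

(** [None] is the point at infinity of Q u {oo}. *)
Definition P1Q := option rat.
Definition inftyQ : P1Q := None.

Definition moebius (A : 'M[int]_2) (x : P1Q) : P1Q :=
  let a : rat := (A 0 0)%:~R in let b : rat := (A 0 1)%:~R in
  let c : rat := (A 1 0)%:~R in let d : rat := (A 1 1)%:~R in
  match x with
  | None => if c == 0 then None else Some (a / c)
  | Some t => if c * t + d == 0 then None
              else Some ((a * t + b) / (c * t + d))
  end.

Definition cusps (G : set 'M[int]_2) : set (set P1Q) :=
  [set [set moebius A x | A in G] | x in [set: P1Q]].

Definition cusp_representatives (G : set 'M[int]_2) (cs : seq P1Q) : Prop :=
  uniq cs /\ forall C, cusps G C -> exists! c, c \in cs /\ C c.

Definition transvection (w : nat) : 'M[int]_2 :=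
  \matrix_(i, j) (if i == j then 1 else if i == 0 then w%:Z else 0).

Definition conjugate_group (G : set 'M[int]_2) (g : 'M[int]_2)
    : set 'M[int]_2 :=
  [set invmx g *m h *m g | h in G].

(** The condition does not depend on the choice of [g], and SL(2,Z) is
    transitive on Q u {oo}. *)
Definition cusp_width (G : set 'M[int]_2) (c : P1Q) (w : nat) : Prop :=
  forall g, SL2Z g -> moebius g inftyQ = c ->
    [/\ (0 < w)%N, conjugate_group G g (transvection w) &
        forall w', (0 < w')%N -> conjugate_group G g (transvection w') ->
          (w <= w')%N].

Definition veech_data (R : realType) (X : tsurface R)
    (n : nat) (cs : seq P1Q) (ws : seq nat) : Prop :=
  [/\ veech_group X `<=` [set intmx R A | A in SL2Z],
      has_index SL2Z (veech_groupZ X) n,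
      cusp_representatives (veech_groupZ X) cs &
      List.Forall2 (cusp_width (veech_groupZ X)) cs ws].

(** Cycles are written with the labels 1, ..., N; the label k corresponds to
    the ordinal k - 1 of ['I_N].  Recall that [next c k = k] if k is not in c. *)

Definition disjoint_cycles (N : nat) (cs : seq (seq nat)) : bool :=
  uniq (flatten cs) && all (fun k => 0 < k <= N)%N (flatten cs).

Definition cycles_fun (cs : seq (seq nat)) (k : nat) : nat :=
  foldr (fun c => next c) k cs.

Section PermOfCycles.
Variables (N : nat) (cs : seq (seq nat)) (Hcs : disjoint_cycles N cs).

Lemma cycles_fun_bound k : (0 < k <= N -> 0 < cycles_fun cs k <= N)%N.
Proof.
move=> hk; case/andP: Hcs => _; elim: cs => [|c l IH] //=.
rewrite all_cat => /andP[/allP hc /IH {IH}].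
rewrite -/(cycles_fun l k); set m := cycles_fun l k => hm.
have [mc|mc] := boolP (m \in c); first by apply: hc; rewrite mem_next.
by rewrite next_nth (negPf mc).
Qed.

Lemma cycles_fun_inj : injective (cycles_fun cs).
Proof.
case/andP: Hcs => + _; elim: cs => [|c l IH] /=; first by move=> _ x y.
rewrite cat_uniq => /and3P[uc _ /IH{}IH] x y /= /(can_inj (prev_next uc)).
exact: IH.
Qed.

Lemma cycles_ord_subproof (i : 'I_N) : ((cycles_fun cs i.+1).-1 < N)%N.
Proof.
have /andP[] := @cycles_fun_bound i.+1 (ltn_ord i).
by case: (cycles_fun cs i.+1).
Qed.

Definition cycles_ord (i : 'I_N) : 'I_N := Ordinal (cycles_ord_subproof i).

Lemma cycles_ord_inj : injective cycles_ord.
Proof.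
move=> i j /(congr1 val) /= eij.
have /andP[i0 _] := @cycles_fun_bound i.+1 (ltn_ord i).
have /andP[j0 _] := @cycles_fun_bound j.+1 (ltn_ord j).
have /cycles_fun_inj[/val_inj//] : cycles_fun cs i.+1 = cycles_fun cs j.+1.
by rewrite -(prednK i0) -(prednK j0) eij.
Qed.

Definition perm_of_cycles : {perm 'I_N} := perm cycles_ord_inj.

End PermOfCycles.

Definition blocks (m l : nat) : seq (seq nat) :=
  [seq iota (j * l).+1 l | j <- iota 0 m].

Definition mucube_v : seq (seq nat) := ([::
  [:: 1; 9; 14; 22]; [:: 2; 20; 13; 7]; [:: 3; 24; 16; 11];
  [:: 4; 5; 15; 18]; [:: 6; 10; 17; 21]; [:: 8; 23; 19; 12]])%N.

Definition muoctahedron_v : seq (seq nat) := ([::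
  [:: 1; 10; 3; 37; 54; 39; 36; 20; 29];
  [:: 2; 11; 19; 28; 21; 53; 38; 46; 18];
  [:: 4; 16; 6; 33; 23; 35; 58; 70; 60];
  [:: 5; 17; 69; 59; 71; 22; 34; 24; 15];
  [:: 7; 13; 9; 55; 64; 57; 40; 51; 42];
  [:: 8; 14; 50; 41; 52; 72; 56; 65; 12];
  [:: 25; 31; 27; 66; 62; 68; 47; 44; 49];
  [:: 26; 32; 43; 48; 45; 61; 67; 63; 30]])%N.

Definition mutetrahedron_v : seq (seq nat) := ([::
  [:: 1; 7; 13; 11; 3; 21];
  [:: 2; 20; 14; 12; 18; 22];
  [:: 4; 10; 16; 8; 6; 24];
  [:: 5; 23; 17; 9; 15; 19]])%N.

Definition octa4_v : seq (seq nat) := ([::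
  [:: 1; 6; 35];
  [:: 2; 32; 41];
  [:: 3; 48; 7];
  [:: 4; 9; 10];
  [:: 5; 38; 20];
  [:: 8; 17; 26];
  [:: 11; 25; 30];
  [:: 12; 43; 39];
  [:: 13; 18; 47];
  [:: 14; 44; 29];
  [:: 15; 36; 19];
  [:: 16; 21; 22];
  [:: 23; 37; 42];
  [:: 24; 31; 27];
  [:: 28; 33; 34];
  [:: 40; 45; 46]])%N.

Definition truncated_octa8_v : seq (seq nat) := ([::
  [:: 1; 34; 75; 81; 120; 7];
  [:: 2; 20; 111; 80; 62; 25];
  [:: 3; 40; 67; 79; 107; 15];
  [:: 4; 10; 117; 84; 78; 31];
  [:: 5; 28; 65; 83; 114; 23];
  [:: 6; 18; 104; 82; 70; 37];
  [:: 8; 52; 71; 74; 96; 17];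
  [:: 9; 24; 86; 73; 64; 43];
  [:: 11; 14; 93; 77; 68; 49];
  [:: 12; 46; 61; 76; 89; 21];
  [:: 13; 22; 99; 69; 66; 55];
  [:: 16; 58; 63; 72; 102; 19];
  [:: 26; 45; 115; 110; 90; 33];
  [:: 27; 38; 98; 109; 103; 56];
  [:: 29; 36; 87; 113; 118; 48];
  [:: 30; 59; 106; 112; 101; 41];
  [:: 32; 92; 108; 116; 50; 39];
  [:: 35; 42; 53; 119; 105; 95];
  [:: 44; 57; 91; 85; 97; 51];
  [:: 47; 54; 100; 88; 94; 60]])%N.

Fact mucube_h_ok : disjoint_cycles 24 (blocks 6 4).
Proof. by vm_compute. Qed.
Fact mucube_v_ok : disjoint_cycles 24 mucube_v.
Proof. by vm_compute. Qed.
Definition mucube (R : realType) : tsurface R :=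
  square_tiled R
    (perm_of_cycles mucube_h_ok) (perm_of_cycles mucube_v_ok).

Fact muoctahedron_h_ok : disjoint_cycles 72 (blocks 8 9).
Proof. by vm_compute. Qed.
Fact muoctahedron_v_ok : disjoint_cycles 72 muoctahedron_v.
Proof. by vm_compute. Qed.
Definition muoctahedron (R : realType) : tsurface R :=
  square_tiled R
    (perm_of_cycles muoctahedron_h_ok) (perm_of_cycles muoctahedron_v_ok).

Fact mutetrahedron_h_ok : disjoint_cycles 24 (blocks 4 6).
Proof. by vm_compute. Qed.
Fact mutetrahedron_v_ok : disjoint_cycles 24 mutetrahedron_v.
Proof. by vm_compute. Qed.
Definition mutetrahedron (R : realType) : tsurface R :=
  square_tiled R
    (perm_of_cycles mutetrahedron_h_ok) (perm_of_cycles mutetrahedron_v_ok).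

Fact octa4_h_ok : disjoint_cycles 48 (blocks 16 3).
Proof. by vm_compute. Qed.
Fact octa4_v_ok : disjoint_cycles 48 octa4_v.
Proof. by vm_compute. Qed.
Definition octa4 (R : realType) : tsurface R :=
  square_tiled R
    (perm_of_cycles octa4_h_ok) (perm_of_cycles octa4_v_ok).

Fact truncated_octa8_h_ok : disjoint_cycles 120 (blocks 20 6).
Proof. by vm_compute. Qed.
Fact truncated_octa8_v_ok : disjoint_cycles 120 truncated_octa8_v.
Proof. by vm_compute. Qed.
Definition truncated_octa8 (R : realType) : tsurface R :=
  square_tiled R
    (perm_of_cycles truncated_octa8_h_ok) (perm_of_cycles truncated_octa8_v_ok).

(* Main.v *)
Require Import Defs.
From Stdlib Require List.
From Stdlib Require Import Relation_Operators.
From mathcomp Require Import all_boot all_order all_fingroup all_algebra.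
From mathcomp Require Import generic_quotient.
From mathcomp Require Import all_classical all_reals all_analysis.
From mathcomp Require Import ring lra zify.

Set Implicit Arguments.
Unset Strict Implicit.
Unset Printing Implicit Defensive.

Import Order.TTheory GRing.Theory Num.Theory.
Import numFieldNormedType.Exports.

Local Open Scope classical_set_scope.
Local Open Scope card_scope.
Local Open Scope ring_scope.

(** Let X be the surface of the pair of permutations (h, v).  A quarter turn of
    every square identifies the rotated surface with that of (v^-1, h), and the
    horizontal shear, cutting every square along its antidiagonal, identifies the
    sheared surface with that of (h, v') where v' maps h(i) to v(i)
    ([rotate_iso], [shear_iso]).  Since these two matrices generate SL(2,Z)
    ([SL2Z_ind]), every g X with g in SL(2,Z) is the surface of a pair in a finite
    orbit, and conjugate pairs give isomorphic surfaces ([relabel_iso]).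

    Conversely, let f be a homeomorphism with derivative A between two such
    surfaces.  Away from the vertices the surfaces have charts and cover the torus
    R^2/Z^2, and f maps a straight path with vector d to one with vector A d
    ([lies_over_path]); a vertex of cone angle larger than 2 pi has no chart
    ([singular_corner]), so f maps it to a vertex.  An edge that joins two singular
    vertices therefore forces A to map its vector into Z^2.  With a horizontal and
    a vertical edge of this kind, the Veech group is contained in SL(2,Z)
    ([iso_integral]).  If A = 1, then f commutes with the projections to the torus,
    hence permutes the squares and respects the gluings: the two pairs of
    permutations are conjugate ([translation_iso_conj]).

    So g belongs to the Veech group if and only if its action fixes the conjugacy
    class of (h, v), and the left cosets of the Veech group correspond to the
    classes in the orbit.  Labelling g by the class of g X, the cusp g(oo) depends
    only on the orbit under the shear of the label of g^-1, and its width is the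
    length of this orbit ([same_cusp_label], [label_same_cusp], [cusp_widthP]).
    What remains is the finite graph of the action of the two generators on the
    orbit, which is computed with tables of the permutations ([certifiedP]).
    Representatives in the orbit are told apart from (h, v) by loops: walks that
    return to their start from the first square of the given surface, but for
    every starting square fail to do so in the other one for at least one of the
    walks. *)

(** * Coordinates on the glued squares *)

Section Coordinates.
Variable R : realType.
Implicit Types x y : R.

Definition vec x y : 'cV[R]_2 := \col_k (if k == 0 then x else y).

Definition unitI x : bool := 0 <= x <= 1.

Lemma vec0 x y : vec x y 0 0 = x. Proof. by rewrite mxE. Qed.
Lemma vec1 x y : vec x y 1 0 = y. Proof. by rewrite mxE. Qed.

Lemma vecP (p q : 'cV[R]_2) : p 0 0 = q 0 0 -> p 1 0 = q 1 0 -> p = q.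
Proof.
move=> e0 e1; apply/matrixP => k l; rewrite (ord1 l) {l}.
have [->//|k0] := eqVneq k 0.
suff -> : k = 1 by [].
by apply/val_inj; case: k k0 => [[|[|]]].
Qed.

Lemma vec_eta (p : 'cV[R]_2) : p = vec (p 0 0) (p 1 0).
Proof. by apply: vecP; rewrite ?vec0 ?vec1. Qed.

Lemma ord2P (P : 'I_2 -> Prop) : P 0 -> P 1 -> forall k, P k.
Proof.
move=> P0 P1 k; have [->//|k0] := eqVneq k 0.
suff -> : k = 1 by [].
by apply/val_inj; case: k k0 => [[|[|]]].
Qed.

Definition clamp x : R := Num.max 0 (Num.min 1 x).

Lemma clamp_unitI x : unitI (clamp x).
Proof. by rewrite /unitI /clamp le_max lexx /= ge_max ler01 /= ge_min lexx. Qed.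

Lemma clampE x : unitI x -> clamp x = x.
Proof. by case/andP=> x0 x1; rewrite /clamp min_r // max_r. Qed.

Lemma sqpt_subproof x y : vec (clamp x) (clamp y) \in @unit_square R.
Proof.
apply/mem_set; apply: ord2P; rewrite ?vec0 ?vec1; exact: clamp_unitI.
Qed.

(** Clamping the coordinates makes every pair of reals name a point of the
    square, so that no membership proofs have to be carried around. *)
Definition sqpt x y : set_type (@unit_square R) :=
  exist (fun p => p \in @unit_square R) _ (sqpt_subproof x y).

Lemma sqptE x y : unitI x -> unitI y -> set_val (sqpt x y) = vec x y.
Proof. by move=> Ix Iy; rewrite set_valE /= !clampE. Qed.

Lemma sqpt_surj (p : set_type (@unit_square R)) :
  exists x y, [/\ unitI x, unitI y & p = sqpt x y].
Proof.
have pP : unit_square (set_val p) by exact: set_valP.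
exists (set_val p 0 0), (set_val p 1 0).
have I0 : unitI (set_val p 0 0) by exact: pP.
have I1 : unitI (set_val p 1 0) by exact: pP.
split => //; apply: val_inj; rewrite -!set_valE sqptE //; exact: vec_eta.
Qed.

Lemma nbhs_vecP (p : 'cV[R]_2) (P : set 'cV[R]_2) :
  nbhs p P <-> exists2 e, 0 < e & forall q : 'cV[R]_2,
    `|q 0 0 - p 0 0| < e -> `|q 1 0 - p 1 0| < e -> P q.
Proof.
split=> [/nbhs_ballP[e /= e0 eP]|[e e0 eP]]; last (apply/nbhs_ballP; exists e => //).
  exists e => //.
  move=> q q0 q1; apply: eP; split => //; move=> k l; rewrite (ord1 l).
  by move: k; apply: ord2P; rewrite /ball /= distrC.
move=> q [_ qe]; apply: eP; rewrite distrC; exact: qe.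
Qed.

(** The trace of a neighbourhood on the closed square, also at its boundary: the
    topology of the glued surface is handled through this condition alone. *)
Definition near_in x y (Q : R -> R -> Prop) : Prop :=
  exists2 e, 0 < e & forall x' y', unitI x' -> unitI y' ->
    `|x' - x| < e -> `|y' - y| < e -> Q x' y'.

Lemma near_inS x y (P Q : R -> R -> Prop) :
  (forall x' y', unitI x' -> unitI y' -> P x' y' -> Q x' y') ->
  near_in x y P -> near_in x y Q.
Proof.
by move=> PQ [e e0 eP]; exists e => // x' y' Ix Iy hx hy; apply: PQ (eP _ _ _ _ _ _).
Qed.

Lemma near_inI x y (P Q : R -> R -> Prop) :
  near_in x y P -> near_in x y Q -> near_in x y (fun x' y' => P x' y' /\ Q x' y').
Proof.
move=> [e e0 eP] [d d0 dQ]; exists (Num.min e d); first by rewrite lt_min e0.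
by move=> x' y' Ix Iy; rewrite !lt_min => /andP[? ?] /andP[? ?]; split; [apply: eP|apply: dQ].
Qed.

Lemma near_sqpt x y (P : set_type (@unit_square R) -> Prop) :
  unitI x -> unitI y ->
  (\forall q \near sqpt x y, P q) <-> near_in x y (fun x' y' => P (sqpt x' y')).
Proof.
move=> Ix Iy; split.
  case=> _ [[W oW <-] Wx WP].
  have /nbhs_vecP[e e0 eW] : nbhs (set_val (sqpt x y)) W by exact: open_nbhs_nbhs.
  exists e => // x' y' Ix' Iy' hx hy; apply: WP; rewrite /preimage /=; apply: eW.
    by rewrite !sqptE // !vec0.
  by rewrite !sqptE // !vec1.
case=> e e0 eP.
have : nbhs (set_val (sqpt x y))
   [set q : 'cV[R]_2 | `|q 0 0 - x| < e /\ `|q 1 0 - y| < e].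
  apply/nbhs_vecP; exists e => // q; rewrite sqptE // vec0 vec1 //=.
rewrite nbhsE => -[W [oW Wx] WP].
exists (set_val @^-1` W); split => //=; first by exists W.
move=> q /WP /=; have [x' [y' [Ix' Iy' ->]]] := sqpt_surj q.
by rewrite sqptE // vec0 vec1 => -[? ?]; apply: eP.
Qed.

End Coordinates.

Section Surface.
Variables (R : realType) (N : nat) (sh sv : {perm 'I_N}).
Implicit Types (i j : 'I_N) (x y : R).
Local Notation X := (glued_space R sh sv).

Definition sq i x y : X := square_map sh sv i (sqpt x y).

Lemma sq_surj (a : X) : exists i x y, [/\ unitI x, unitI y & a = sq i x y].
Proof.
have -> : a = (\pi_{eq_quot (glue_equiv R sh sv)} (repr a))%qT by rewrite reprK.
case: (repr a) => i p; have [x [y [Ix Iy ->]]] := sqpt_surj p.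
by exists i, x, y.
Qed.

Lemma sq_right i y : unitI y -> sq i 1 y = sq (sh i) 0 y.
Proof.
move=> Iy; apply/eqmodP; apply/asboolP; apply: rst_step; constructor.
- by rewrite sqptE ?vec0 // /unitI ler01 lexx.
- by rewrite sqptE ?vec0 // /unitI ler01 lexx.
- by rewrite !sqptE ?vec1 // /unitI ?ler01 ?lexx.
Qed.

Lemma sq_top i x : unitI x -> sq i x 1 = sq (sv i) x 0.
Proof.
move=> Ix; apply/eqmodP; apply/asboolP; apply: rst_step; constructor.
- by rewrite sqptE ?vec1 // /unitI ler01 lexx.
- by rewrite sqptE ?vec1 // /unitI ler01 lexx.
- by rewrite !sqptE ?vec0 // /unitI ?ler01 ?lexx.
Qed.

(** The universal property of the gluing, from which all maps, charts and
    invariants below arise. *)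
Lemma lift_glued (T : Type) (F : 'I_N -> R -> R -> T) :
  (forall i y, unitI y -> F i 1 y = F (sh i) 0 y) ->
  (forall i x, unitI x -> F i x 1 = F (sv i) x 0) ->
  exists f : X -> T,
    forall i x y, unitI x -> unitI y -> f (sq i x y) = F i x y.
Proof.
move=> Fr Ft.
pose G (a : squares R N) := F (projT1 a) (set_val (projT2 a) 0 0) (set_val (projT2 a) 1 0).
have Gglue a b : glued sh sv a b -> G a = G b.
  by case=> i p q; rewrite /G /= => -> -> ->; rewrite ?Fr ?Ft //; exact: (set_valP q).
have Grst a b : clos_refl_sym_trans _ (glued sh sv) a b -> G a = G b.
  by elim=> [? ? /Gglue|?|? ? _ ->|? ? ? _ -> _ ->].
exists (fun a => G (repr a)) => i x y Ix Iy.
have -> : G (repr (sq i x y)) = G (existT _ i (sqpt x y)).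
  apply: Grst; apply/asboolP.
  have /eqmodP // : (\pi_{eq_quot (glue_equiv R sh sv)} (repr (sq i x y)) = sq i x y)%qT.
  by rewrite reprK.
by rewrite /G /= !sqptE // vec0 vec1.
Qed.

Lemma open_sqP (U : set X) :
  open U <-> forall i x y, unitI x -> unitI y -> U (sq i x y) ->
    near_in x y (fun x' y' => U (sq i x' y')).
Proof.
rewrite -[open U]/(open (\pi_{eq_quot (glue_equiv R sh sv)}%qT @^-1` U)).
rewrite sigT_openP; split=> oU i.
  move=> x y Ix Iy Ui.
  by have := oU i; rewrite openE => /(_ (sqpt x y) Ui) /near_sqpt; apply.
rewrite openE => p; have [x [y [Ix Iy ->]]] := sqpt_surj p => Up.
by apply/near_sqpt => //; apply: oU.
Qed.

End Surface.

(** * Maps that are affine on the squares *)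

Section Charts.
Variables (R : realType) (N : nat) (sh sv : {perm 'I_N}).
Local Notation X := (glued_space R sh sv).
Local Notation sq := (sq sh sv).

Definition translates (U : set X) (phi : X -> 'cV[R]_2) : Prop :=
  forall i x y, unitI x -> unitI y -> U (sq i x y) ->
    near_in x y (fun x' y' =>
      phi (sq i x' y') = phi (sq i x y) + vec (x' - x) (y' - y)).

Lemma translates_continuous (U : set X) phi (a : X) :
  open U -> translates U phi -> U a -> {for a, continuous phi}.
Proof.
move=> oU tU Ua W /nbhs_vecP[e e0 eW].
pose V : set X := [set b | U b /\
  (`|phi b 0 0 - phi a 0 0| < e /\ `|phi b 1 0 - phi a 1 0| < e)].
suff oV : open V.
  apply: (@filterS _ (nbhs a) _ V); first by move=> b [_ [? ?]]; apply: eW.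
  by apply: open_nbhs_nbhs; split => //; rewrite /V /= !subrr normr0.
apply/open_sqP => i x y Ix Iy [Ub [b0 b1]].
have [d d0 dU] := (open_sqP U).1 oU i x y Ix Iy Ub.
have [c c0 cU] := tU i x y Ix Iy Ub.
set p0 := phi (sq i x y) 0 0 in b0; set p1 := phi (sq i x y) 1 0 in b1.
exists (Num.min (Num.min d c) (Num.min (e - `|p0 - phi a 0 0|) (e - `|p1 - phi a 1 0|))).
  by rewrite !lt_min d0 c0 !subr_gt0 b0.
move=> x' y' Ix' Iy'; rewrite !lt_min => /andP[/andP[xd xc] /andP[xe _]].
move=> /andP[/andP[yd yc] /andP[_ ye]]; split; first exact: dU.
rewrite (cU x' y') // mxE [in X in _ /\ X]mxE vec0 vec1 -/p0 -/p1; split.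
  rewrite addrAC; apply: le_lt_trans (ler_normD _ _) _; lra.
rewrite addrAC; apply: le_lt_trans (ler_normD _ _) _; lra.
Qed.

(** Continuity of a chart follows from its being a translation in every square. *)
Lemma square_chartP (U : set X) phi :
  square_chart U phi <->
  [/\ open U, set_inj U phi,
      forall V : set X, open V -> V `<=` U -> open (phi @` V) &
      translates U phi].
Proof.
have E i x y x' y' : unitI x -> unitI y -> unitI x' -> unitI y' ->
  (phi (sq i x' y') - set_val (sqpt x' y') = phi (sq i x y) - set_val (sqpt x y))
  <-> (phi (sq i x' y') = phi (sq i x y) + vec (x' - x) (y' - y)).
  move=> Ix Iy Ix' Iy'; rewrite !sqptE //.
  have -> : vec (x' - x) (y' - y) = vec x' y' - vec x y.
    by apply: vecP; rewrite !mxE.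
  split=> [/(canRL (subrK _)) ->|->]; first by rewrite addrAC -addrA.
  by rewrite addrA addrAC addrK.
split=> [[oU iU _ mU tU]|[oU iU mU tU]]; split => //.
- move=> i x y Ix Iy Ui.
  have /near_sqpt := tU i (sqpt x y) Ui.
  move=> /(_ Ix Iy); apply: near_inS => x' y' Ix' Iy' h.
  exact/E.
- by move=> a Ua; exact: translates_continuous Ua.
- move=> i p; have [x [y [Ix Iy ->]]] := sqpt_surj p => Ui.
  apply/near_sqpt => //; have := tU i x y Ix Iy Ui.
  by apply: near_inS => x' y' Ix' Iy' h; apply/E.
Qed.

End Charts.

Section LinearMaps.
Variable R : realType.
Implicit Types (A B : 'M[R]_2) (x y : R).

Lemma mulmx_vec A x y :
  A *m vec x y = vec (A 0 0 * x + A 0 1 * y) (A 1 0 * x + A 1 1 * y).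
Proof.
by apply: vecP; rewrite !mxE !big_ord_recl big_ord0 !mxE /= addr0;
   congr (_ + _ * _); congr (A _ _); apply/val_inj.
Qed.

Lemma mulmx_small A (e : R) : 0 < e -> exists2 d, 0 < d & forall x y,
  `|x| < d -> `|y| < d ->
  `|(A *m vec x y) 0 0| < e /\ `|(A *m vec x y) 1 0| < e.
Proof.
move=> e0; pose M := 1 + `|A 0 0| + `|A 0 1| + `|A 1 0| + `|A 1 1|.
have M0 : 0 < M by rewrite /M; have := (normr_ge0 (A 0 0), normr_ge0 (A 0 1),
  normr_ge0 (A 1 0), normr_ge0 (A 1 1)); move=> [[[? ?] ?] ?]; lra.
exists (e / M) => [|x y hx hy]; first by rewrite divr_gt0.
have bnd (s t : R) : `|s| + `|t| < M -> `|s * x + t * y| < e.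
  move=> st; have d0 : 0 < e / M by rewrite divr_gt0.
  apply: le_lt_trans (ler_normD _ _) _; rewrite !normrM.
  apply: (@le_lt_trans _ _ ((`|s| + `|t|) * (e / M))).
    by rewrite mulrDl lerD // ler_wpM2l // ltW.
  rewrite -[ltRHS](divfK (lt0r_neq0 M0)) [ltRHS]mulrC.
  by rewrite ltr_pM2r.
have := (normr_ge0 (A 0 0), normr_ge0 (A 0 1),
  normr_ge0 (A 1 0), normr_ge0 (A 1 1)); move=> [[[? ?] ?] ?].
by rewrite mulmx_vec vec0 vec1; split; apply: bnd; rewrite /M; lra.
Qed.

Lemma open_mulmx A (W : set 'cV[R]_2) : A \in unitmx -> open W ->
  open ((fun p => A *m p) @` W).
Proof.
move=> uA; rewrite !openE => oW _ [p Wp <-].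
have /nbhs_vecP[e e0 eW] := oW p Wp.
have [d d0 dA] := mulmx_small (invmx A) e0.
apply/nbhs_vecP; exists d => // q hq0 hq1.
exists (invmx A *m q); last by rewrite mulKVmx.
pose w := invmx A *m vec ((q - A *m p) 0 0) ((q - A *m p) 1 0).
have -> : invmx A *m q = p + w.
  by rewrite /w -vec_eta mulmxBr mulKmx // addrC subrK.
have [|| h0 h1] := dA ((q - A *m p) 0 0) ((q - A *m p) 1 0).
- by move: hq0; rewrite !mxE.
- by move: hq1; rewrite !mxE.
by apply: eW; rewrite mxE [_ + w _ _]addrC addrK.
Qed.

End LinearMaps.

Section AffineMaps.
Variables (R : realType) (N M : nat).

(** Two points of the target suffice to describe an affine map near a point:
    the image of a small piece of a square may cross one edge. *)
Definition affine_at (sh sv : {perm 'I_N}) (sh' sv' : {perm 'I_M})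
    (A : 'M[R]_2) (f : glued_space R sh sv -> glued_space R sh' sv')
    (i : 'I_N) (x y : R) : Prop :=
  exists j1 a1 b1 j2 a2 b2,
  [/\ [/\ unitI a1, unitI b1, unitI a2 & unitI b2],
      f (sq sh sv i x y) = sq sh' sv' j1 a1 b1,
      f (sq sh sv i x y) = sq sh' sv' j2 a2 b2 &
      near_in x y (fun x' y' => exists a' b',
        [/\ unitI a', unitI b' &
         (f (sq sh sv i x' y') = sq sh' sv' j1 a' b' /\
          vec (a' - a1) (b' - b1) = A *m vec (x' - x) (y' - y)) \/
         (f (sq sh sv i x' y') = sq sh' sv' j2 a' b' /\
          vec (a' - a2) (b' - b2) = A *m vec (x' - x) (y' - y))])].

Definition affine_map (sh sv : {perm 'I_N}) (sh' sv' : {perm 'I_M})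
    (A : 'M[R]_2) (f : glued_space R sh sv -> glued_space R sh' sv') : Prop :=
  forall i x y, unitI x -> unitI y -> affine_at A f i x y.

Variables (sh sv : {perm 'I_N}) (sh' sv' : {perm 'I_M}) (A : 'M[R]_2).
Variable f : glued_space R sh sv -> glued_space R sh' sv'.
Hypothesis fA : affine_map A f.
Local Notation sqX := (sq sh sv).
Local Notation sqY := (sq sh' sv').

(** Near a point [f] is described by at most two squares of the target, so the
    smaller of two radii works. *)
Lemma affine_near i x y (Q : glued_space R sh' sv' -> 'cV[R]_2 -> Prop) :
  unitI x -> unitI y ->
  (forall j a b, unitI a -> unitI b -> f (sqX i x y) = sqY j a b ->
     near_in a b (fun a' b' => Q (sqY j a' b') (vec (a' - a) (b' - b)))) ->
  near_in x y (fun x' y' => Q (f (sqX i x' y')) (A *m vec (x' - x) (y' - y))).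
Proof.
move=> Ix Iy QP.
have [j1 [a1 [b1 [j2 [a2 [b2 [[Ia1 Ib1 Ia2 Ib2] f1 f2 [e e0 ef]]]]]]]] := fA i Ix Iy.
have [e1 e10 Q1] := QP _ _ _ Ia1 Ib1 f1.
have [e2 e20 Q2] := QP _ _ _ Ia2 Ib2 f2.
have [|d d0 dA] := @mulmx_small R A (Num.min e1 e2); first by rewrite lt_min e10.
exists (Num.min e d) => [|x' y' Ix' Iy']; first by rewrite lt_min e0.
rewrite !lt_min => /andP[xe xd] /andP[ye yd].
have [a' [b' [Ia' Ib' H]]] := ef _ _ Ix' Iy' xe ye.
have [] := dA _ _ xd yd; case: H => -[-> <-]; rewrite vec0 vec1 !lt_min.
- by move=> /andP[? _] /andP[? _]; apply: Q1.
- by move=> /andP[_ ?] /andP[_ ?]; apply: Q2.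
Qed.

Lemma affine_continuous : continuous f.
Proof.
apply/continuousP => V oV; apply/open_sqP => i x y Ix Iy Vf.
apply: (affine_near (Q := fun b _ => V b)) => // j a b Ia Ib fE.
by apply: (open_sqP V).1 => //; rewrite -fE.
Qed.

Variable g : glued_space R sh' sv' -> glued_space R sh sv.
Hypotheses (fK : cancel f g) (gK : cancel g f) (cg : continuous g).
Hypothesis uA : A \in unitmx.

(** Undoing the derivative of [f] turns the pullback of a chart back into a map
    that translates every square. *)
Lemma affine_chart (U : set (glued_space R sh' sv')) phi :
  square_chart U phi ->
  square_chart (f @^-1` U) (fun a => invmx A *m phi (f a)).
Proof.
move=> /square_chartP[oU iU mU tU]; apply/square_chartP; split.
- by move/continuousP: affine_continuous; apply.
- move=> a b; rewrite !inE => Ua Ub /(congr1 (mulmx A)); rewrite !mulKVmx //.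
  by move/iU; rewrite !inE => /(_ Ua Ub); exact: can_inj fK _ _.
- move=> V oV VU.
  have -> : (fun a => invmx A *m phi (f a)) @` V =
     (fun p => invmx A *m p) @` (phi @` (g @^-1` V)).
    apply/seteqP; split=> [_ [a Va <-]|_ [_ [b Vb <-] <-]].
      by exists (phi (f a)) => //; exists (f a) => //=; rewrite fK.
    by exists (g b) => //=; rewrite gK.
  apply: open_mulmx; first by rewrite unitmx_inv.
  apply: mU; first by move/continuousP: cg; apply.
  by move=> b /= Vb; rewrite -[b]gK; exact: VU.
- move=> i x y Ix Iy Uf.
  have := @affine_near i x y (fun b v => phi b = phi (f (sqX i x y)) + v) Ix Iy.
  have H : (forall j a b, unitI a -> unitI b ->
    f (sqX i x y) = sqY j a b ->
    near_in a b
      (fun a' b' => phi (sqY j a' b') = phi (f (sqX i x y)) + vec (a' - a) (b' - b))).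
    by move=> j a b Ia Ib fE; rewrite fE; apply: tU => //; rewrite -fE.
  move=> /(_ H); apply: near_inS => x' y' _ _ ->.
  by rewrite mulmxDr mulKmx.
Qed.

End AffineMaps.

(** A chart of the target pulls back along [f] and a chart of the source along
    [g], which gives the two directions of the correspondence of atlases. *)
Lemma affine_iso (R : realType) (N M : nat) (sh sv : {perm 'I_N})
    (sh' sv' : {perm 'I_M}) (A : 'M[R]_2)
    (f : glued_space R sh sv -> glued_space R sh' sv')
    (g : glued_space R sh' sv' -> glued_space R sh sv) :
  A \in unitmx -> cancel f g -> cancel g f ->
  affine_map A f -> affine_map (invmx A) g ->
  tsurface_iso (sl_act A (square_tiled R sh sv)) (square_tiled R sh' sv').
Proof.
move=> uA fK gK fA gA; exists f, g.
have cf := affine_continuous fA; have cg := affine_continuous gA.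
split => // U phi /=; split=> [cU|[psi cpsi phiE]].
  exists (fun a => invmx A *m phi (f a)); first exact: affine_chart cU.
  by apply/funext => a /=; rewrite mulKVmx.
have uB : invmx A \in unitmx by rewrite unitmx_inv.
have := affine_chart gA gK fK cf uB cpsi.
rewrite invmxK -comp_preimage (_ : f \o g = id) ?preimage_id; last exact/funext.
rewrite (_ : (fun a => _) = phi) //; apply/funext => b /=.
by have /(congr1 (fun h => h (g b))) /= := phiE; rewrite gK.
Qed.

(** * Relabelling, rotating and shearing the squares *)

Definition mx2 (K : pzRingType) (a b c d : K) : 'M[K]_2 :=
  \matrix_(i, j) if i == 0 then (if j == 0 then a else b)
                 else (if j == 0 then c else d).

Lemma mx2P (K : pzRingType) (A B : 'M[K]_2) : A 0 0 = B 0 0 -> A 0 1 = B 0 1 ->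
  A 1 0 = B 1 0 -> A 1 1 = B 1 1 -> A = B.
Proof.
move=> e00 e01 e10 e11; apply/matrixP => k l.
by move: k l; apply: ord2P; apply: ord2P.
Qed.

Lemma mulmx2 (K : pzRingType) (a b c d a' b' c' d' : K) :
  mx2 a b c d *m mx2 a' b' c' d' =
  mx2 (a * a' + b * c') (a * b' + b * d') (c * a' + d * c') (c * b' + d * d').
Proof.
by apply: mx2P; rewrite !mxE !big_ord_recl big_ord0 !mxE /= addr0.
Qed.

Lemma mx2_1 (K : pzRingType) : mx2 1 0 0 1 = 1%:M :> 'M[K]_2.
Proof. by apply: mx2P; rewrite !mxE. Qed.

Section Moves.
Variable R : realType.
Implicit Types (x y : R).

Lemma mulmx2_vec (a b c d x y : R) :
  mx2 a b c d *m vec x y = vec (a * x + b * y) (c * x + d * y).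
Proof. by rewrite mulmx_vec !mxE. Qed.

Lemma near_in_lt (a b c x y : R) :
  a * x + b * y < c -> near_in x y (fun x' y' => a * x' + b * y' < c).
Proof.
rewrite -subr_gt0 => /(mulmx_small (mx2 a b 0 0))[d d0 dP].
exists d => // x' y' _ _ hx hy; have [+ _] := dP _ _ hx hy.
rewrite mulmx2_vec vec0 => /(le_lt_trans (ler_norm _)).
rewrite !mulrBr; lra.
Qed.

Lemma near_in_true x y (Q : R -> R -> Prop) :
  (forall x' y', unitI x' -> unitI y' -> Q x' y') -> near_in x y Q.
Proof. by move=> QP; exists 1 => // *; apply: QP. Qed.

Variable N : nat.
Implicit Types (sh sv : {perm 'I_N}) (i j : 'I_N).

Lemma affine_isoP sh sv sh' sv' (A B : 'M[R]_2)
    (f : glued_space R sh sv -> glued_space R sh' sv') g :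
  A *m B = 1%:M -> cancel f g -> cancel g f ->
  affine_map A f -> affine_map B g ->
  tsurface_iso (sl_act A (square_tiled R sh sv)) (square_tiled R sh' sv').
Proof.
move=> AB fK gK fA gB; have [uA _] := mulmx1_unit AB.
have BE : B = invmx A by rewrite -[B](mulKmx uA) AB mulmx1.
by rewrite BE in gB; exact: affine_iso fK gK fA gB.
Qed.

Lemma affine_map_whole sh sv sh' sv' (A : 'M[R]_2)
    (f : glued_space R sh sv -> glued_space R sh' sv') s (F G : R -> R -> R) :
  (forall x y, unitI x -> unitI y -> unitI (F x y) /\ unitI (G x y)) ->
  (forall i x y, unitI x -> unitI y ->
     f (sq sh sv i x y) = sq sh' sv' (s i) (F x y) (G x y)) ->
  (forall x y x' y', vec (F x' y' - F x y) (G x' y' - G x y) =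
     A *m vec (x' - x) (y' - y)) ->
  affine_map A f.
Proof.
move=> FG fE AE i x y Ix Iy; have [IF IG] := FG x y Ix Iy.
exists (s i), (F x y), (G x y), (s i), (F x y), (G x y).
rewrite fE //; split => //; apply: near_in_true => x' y' Ix' Iy'.
have [IF' IG'] := FG _ _ Ix' Iy'.
by exists (F x' y'), (G x' y'); split => //; left; rewrite fE.
Qed.

Lemma relabel_map sh sv sh' sv' (s : {perm 'I_N}) :
  (forall i, s (sh i) = sh' (s i)) -> (forall i, s (sv i) = sv' (s i)) ->
  exists2 f : glued_space R sh sv -> glued_space R sh' sv', affine_map 1%:M f &
    forall i x y, unitI x -> unitI y ->
      f (sq sh sv i x y) = sq sh' sv' (s i) x y.
Proof.
move=> hs vs; have [|| f fE] := @lift_glued R N sh sv _ (fun i x y => sq sh' sv' (s i) x y).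
- by move=> i y Iy; rewrite sq_right // hs.
- by move=> i x Ix; rewrite sq_top // vs.
exists f => //; apply: affine_map_whole fE _ => // x y x' y'.
by rewrite mul1mx.
Qed.

Lemma relabel_iso sh sv sh' sv' (s : {perm 'I_N}) :
  (forall i, s (sh i) = sh' (s i)) -> (forall i, s (sv i) = sv' (s i)) ->
  tsurface_iso (sl_act 1%:M (square_tiled R sh sv)) (square_tiled R sh' sv').
Proof.
move=> hs vs; have [f fA fE] := relabel_map hs vs.
have [|| g gA gE] := @relabel_map sh' sv' sh sv s^-1.
- by move=> i; apply: (@perm_inj _ s); rewrite permKV hs permKV.
- by move=> i; apply: (@perm_inj _ s); rewrite permKV vs permKV.
apply: (affine_isoP _ _ _ fA gA); first by rewrite mul1mx.
- by move=> a; have [i [x [y [Ix Iy ->]]]] := sq_surj a; rewrite fE // gE // permK.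
- by move=> a; have [i [x [y [Ix Iy ->]]]] := sq_surj a; rewrite gE // fE // permKV.
Qed.

Lemma unitI_compl x : unitI x -> unitI (1 - x).
Proof. by rewrite /unitI => /andP[? ?]; apply/andP; split; lra. Qed.

Lemma unitI0 : unitI (0 : R). Proof. by rewrite /unitI lexx ler01. Qed.
Lemma unitI1 : unitI (1 : R). Proof. by rewrite /unitI lexx ler01. Qed.
Local Hint Resolve unitI0 unitI1 : core.

(** In the rotated squares the right neighbour lies above and the upper neighbour
    to the left. *)
Lemma rotate_maps sh sv :
  exists (f : glued_space R sh sv -> glued_space R sv^-1%g sh)
         (g : glued_space R sv^-1%g sh -> glued_space R sh sv),
  [/\ cancel f g, cancel g f, affine_map (mx2 0 (-1) 1 0) f,
      affine_map (mx2 0 1 (-1) 0) g &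
      forall i x y, unitI x -> unitI y ->
        f (sq sh sv i x y) = sq sv^-1%g sh i (1 - y) x].
Proof.
have [|| f fE] := @lift_glued R N sh sv _ (fun i x y => sq sv^-1%g sh i (1 - y) x).
- by move=> i y Iy; rewrite sq_top //; apply: unitI_compl.
- by move=> i x Ix; rewrite subrr subr0 sq_right // permK.
have [|| g gE] := @lift_glued R N sv^-1%g sh _ (fun i x y => sq sh sv i y (1 - x)).
- by move=> i y Iy; rewrite subrr subr0 sq_top // permKV.
- by move=> i x Ix; rewrite sq_right //; apply: unitI_compl.
exists f, g; split => //.
- move=> a; have [i [x [y [Ix Iy ->]]]] := sq_surj a.
  by rewrite fE // gE ?subKr //; apply: unitI_compl.
- move=> a; have [i [x [y [Ix Iy ->]]]] := sq_surj a.
  by rewrite gE // fE ?subKr //; apply: unitI_compl.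
- apply: affine_map_whole fE _ => [x y ? ?|x y x' y'].
    by split => //; exact: unitI_compl.
  by rewrite mulmx2_vec; congr vec; ring.
- apply: affine_map_whole gE _ => [x y ? ?|x y x' y'].
    by split => //; exact: unitI_compl.
  by rewrite mulmx2_vec; congr vec; ring.
Qed.

Lemma rotate_iso sh sv :
  tsurface_iso (sl_act (mx2 0 (-1) 1 0) (square_tiled R sh sv))
               (square_tiled R sv^-1%g sh).
Proof.
have [f [g [fK gK fA gA _]]] := rotate_maps sh sv.
by apply: (affine_isoP _ fK gK fA gA); rewrite mulmx2 -mx2_1; congr mx2; ring.
Qed.

(** The shear cuts every square along its antidiagonal and glues the upper
    triangle to the right neighbour. *)
Lemma shear_map sh sv :
  exists2 f : glued_space R sh sv -> glued_space R sh (sh^-1 * sv)%g,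
    affine_map (mx2 1 1 0 1) f &
    forall i x y, unitI x -> unitI y ->
      f (sq sh sv i x y) =
      if x + y <= 1 then sq sh (sh^-1 * sv)%g i (x + y) y
      else sq sh (sh^-1 * sv)%g (sh i) (x + y - 1) y.
Proof.
have [|| f fE] := @lift_glued R N sh sv _ (fun i x y =>
  if x + y <= 1 then sq sh (sh^-1 * sv)%g i (x + y) y
  else sq sh (sh^-1 * sv)%g (sh i) (x + y - 1) y).
- move=> i y Iy; rewrite add0r; case/andP: (Iy) => y0 y1; rewrite y1.
  case: leP => [h|h]; last by congr sq; ring.
  have -> : y = 0 by lra.
  by rewrite addr0 sq_right.
- move=> i x Ix; rewrite addr0; case/andP: (Ix) => x0 x1; rewrite x1.
  case: leP => [h|h]; last by rewrite addrK sq_top // permM permK.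
  have -> : x = 0 by lra.
  by rewrite add0r sq_right // sq_top // permM permK.
exists f => // i x y Ix Iy.
case/andP: (Ix) => x0 x1; case/andP: (Iy) => y0 y1.
have near_lt : x + y < 1 -> near_in x y (fun x' y' => x' + y' < 1).
  move=> h; have := @near_in_lt 1 1 1 x y; rewrite !mul1r => /(_ h).
  by apply: near_inS => x' y' _ _; rewrite !mul1r.
have near_gt : 1 < x + y -> near_in x y (fun x' y' => 1 < x' + y').
  move=> h; have := @near_in_lt (-1) (-1) (-1) x y.
  rewrite !mulN1r -opprD ltrN2 => /(_ h).
  by apply: near_inS => x' y' _ _; rewrite !mulN1r -opprD ltrN2.
have lower x' y' : unitI x' -> unitI y' -> x' + y' <= 1 -> unitI (x' + y').
  by rewrite /unitI => /andP[? ?] /andP[? ?] ?; apply/andP; split; lra.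
have upper x' y' : unitI x' -> unitI y' -> 1 <= x' + y' -> unitI (x' + y' - 1).
  by rewrite /unitI => /andP[? ?] /andP[? ?] ?; apply/andP; split; lra.
have shear_vec x' y' : vec (x' + y' - (x + y)) (y' - y) =
    mx2 1 1 0 1 *m vec (x' - x) (y' - y).
  by rewrite mulmx2_vec; congr vec; ring.
have shear_vec1 x' y' : vec (x' + y' - 1 - (x + y - 1)) (y' - y) =
    mx2 1 1 0 1 *m vec (x' - x) (y' - y).
  by rewrite mulmx2_vec; congr vec; ring.
have [h|h|h] := ltgtP (x + y) 1.
- exists i, (x + y), y, i, (x + y), y; rewrite fE // ltW //.
  split => //; first by split => //; apply: lower => //; exact: ltW.
  apply: near_inS (near_lt h) => x' y' Ix' Iy' h'.
  exists (x' + y'), y'; split => //; first by apply: lower => //; exact: ltW.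
  by left; rewrite fE // ltW.
- exists (sh i), (x + y - 1), y, (sh i), (x + y - 1), y; rewrite fE // leNgt h /=.
  split => //; first by split => //; apply: upper => //; exact: ltW.
  apply: near_inS (near_gt h) => x' y' Ix' Iy' h'.
  exists (x' + y' - 1), y'; split => //; first by apply: upper => //; exact: ltW.
  by left; rewrite fE // leNgt h'.
- exists i, (x + y), y, (sh i), (x + y - 1), y.
  rewrite fE // h lexx subrr; split => //; first exact: sq_right.
  apply: near_in_true => x' y' Ix' Iy'; rewrite fE //.
  case: leP => h'.
    by exists (x' + y'), y'; split => //; [exact: lower|left; rewrite -shear_vec h].
  exists (x' + y' - 1), y'; split => //; first by apply: upper => //; exact: ltW.
  by right; split => //; rewrite -shear_vec1 h subrr.
Qed.

Lemma unshear_map sh sv :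
  exists2 g : glued_space R sh (sh^-1 * sv)%g -> glued_space R sh sv,
    affine_map (mx2 1 (-1) 0 1) g &
    forall i x y, unitI x -> unitI y ->
      g (sq sh (sh^-1 * sv)%g i x y) =
      if y <= x then sq sh sv i (x - y) y
      else sq sh sv (sh^-1%g i) (x - y + 1) y.
Proof.
have [|| f fE] := @lift_glued R N sh (sh^-1 * sv)%g _ (fun i x y =>
  if y <= x then sq sh sv i (x - y) y
  else sq sh sv (sh^-1%g i) (x - y + 1) y).
- move=> i y Iy; case/andP: (Iy) => y0 y1; rewrite y1 permK.
  case: leP => [h|h]; last by congr sq; ring.
  have -> : y = 0 by lra.
  by rewrite !subr0 sq_right.
- move=> i x Ix; case/andP: (Ix) => x0 x1; rewrite x0 subr0 permM.
  case: leP => [h|h]; last by rewrite subrK sq_top // permM permK.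
  have -> : x = 1 by lra.
  by rewrite subrr -sq_top // sq_right // permKV.
exists f => // i x y Ix Iy.
case/andP: (Ix) => x0 x1; case/andP: (Iy) => y0 y1.
have near_lt : y < x -> near_in x y (fun x' y' => y' < x').
  move=> h; have := @near_in_lt (-1) 1 0 x y; rewrite mul1r mulN1r addrC subr_lt0 => /(_ h).
  by apply: near_inS => x' y' _ _; rewrite mul1r mulN1r addrC subr_lt0.
have near_gt : x < y -> near_in x y (fun x' y' => x' < y').
  move=> h; have := @near_in_lt 1 (-1) 0 x y; rewrite mul1r mulN1r subr_lt0 => /(_ h).
  by apply: near_inS => x' y' _ _; rewrite mul1r mulN1r subr_lt0.
have lower x' y' : unitI x' -> unitI y' -> y' <= x' -> unitI (x' - y').
  by rewrite /unitI => /andP[? ?] /andP[? ?] ?; apply/andP; split; lra.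
have upper x' y' : unitI x' -> unitI y' -> x' <= y' -> unitI (x' - y' + 1).
  by rewrite /unitI => /andP[? ?] /andP[? ?] ?; apply/andP; split; lra.
have shear_vec x' y' : vec (x' - y' - (x - y)) (y' - y) =
    mx2 1 (-1) 0 1 *m vec (x' - x) (y' - y).
  by rewrite mulmx2_vec; congr vec; ring.
have shear_vec1 x' y' : vec (x' - y' + 1 - (x - y + 1)) (y' - y) =
    mx2 1 (-1) 0 1 *m vec (x' - x) (y' - y).
  by rewrite mulmx2_vec; congr vec; ring.
have [h|h|h] := ltgtP y x.
- exists i, (x - y), y, i, (x - y), y; rewrite fE // ltW //.
  split => //; first by split => //; apply: lower => //; exact: ltW.
  apply: near_inS (near_lt h) => x' y' Ix' Iy' h'.
  exists (x' - y'), y'; split => //; first by apply: lower => //; exact: ltW.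
  by left; rewrite fE // ltW.
- exists (sh^-1%g i), (x - y + 1), y, (sh^-1%g i), (x - y + 1), y; rewrite fE // leNgt h /=.
  split => //; first by split => //; apply: upper => //; exact: ltW.
  apply: near_inS (near_gt h) => x' y' Ix' Iy' h'.
  exists (x' - y' + 1), y'; split => //; first by apply: upper => //; exact: ltW.
  by left; rewrite fE // leNgt h'.
- exists i, (x - y), y, (sh^-1%g i), (x - y + 1), y.
  rewrite -h in shear_vec shear_vec1 *.
  rewrite fE // lexx subrr add0r; split => //; first by rewrite sq_right // permKV.
  apply: near_in_true => x' y' Ix' Iy'; rewrite fE //.
  case: leP => h'.
    by exists (x' - y'), y'; split => //; [exact: lower|left; rewrite -shear_vec subrr].
  exists (x' - y' + 1), y'; split => //; first by apply: upper => //; exact: ltW.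
  by right; split => //; rewrite -shear_vec1 subrr add0r.
Qed.

Lemma shear_iso sh sv :
  tsurface_iso (sl_act (mx2 1 1 0 1) (square_tiled R sh sv))
               (square_tiled R sh (sh^-1 * sv)%g).
Proof.
have [f fA fE] := shear_map sh sv; have [g gA gE] := unshear_map sh sv.
apply: (affine_isoP _ _ _ fA gA).
- by rewrite mulmx2 -mx2_1; congr mx2; ring.
- move=> a; have [i [x [y [Ix Iy ->]]]] := sq_surj a; rewrite fE //.
  case/andP: (Ix) => x0 x1; case/andP: (Iy) => y0 y1.
  case: leP => h; rewrite gE //; try by apply/andP; split; lra.
    by rewrite lerDr x0 addrK.
  case: leP => h'; last by rewrite permK; congr sq; ring.
  have -> : x = 1 by lra.
  have -> : 1 + y - 1 - y = 0 by ring.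
  by rewrite sq_right.
- move=> a; have [i [x [y [Ix Iy ->]]]] := sq_surj a; rewrite gE //.
  case/andP: (Ix) => x0 x1; case/andP: (Iy) => y0 y1.
  case: leP => h; rewrite fE //; try by apply/andP; split; lra.
    by rewrite subrK x1.
  have -> : x - y + 1 + y = x + 1 by ring.
  case: leP => h'; last by rewrite addrK permKV.
  have -> : x = 0 by lra.
  by rewrite add0r sq_right // permKV.
Qed.

End Moves.

(** * Regular and singular points *)

Section RegularPoints.
Variables (R : realType) (N : nat).
Implicit Types (x y : R) (i j : 'I_N) (sh sv : {perm 'I_N}).
Local Hint Resolve unitI0 unitI1 : core.

Definition regular sh sv (b : glued_space R sh sv) : Prop :=
  exists U phi, square_chart U phi /\ U b.

(** The chart of a strip: the part of square [i] right of the line [x = a],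
    continued by the part of its right neighbour left of that line.  Cutting at
    [x = a] keeps the chart injective even if [i] is its own neighbour. *)
Lemma strip_chart sh sv i (a : R) : 0 < a < 1 ->
  exists U phi, [/\ square_chart U phi,
    forall x y, a < x <= 1 -> 0 < y < 1 -> U (sq sh sv i x y) &
    forall x y, 0 <= x < a -> 0 < y < 1 -> U (sq sh sv (sh i) x y)].
Proof.
case/andP=> a0 a1.
have left_unit z : a < z -> z <= 1 -> unitI z.
  by move=> ? ?; apply/andP; split; lra.
have right_unit z : 1 <= z -> z < 1 + a -> unitI (z - 1).
  by move=> ? ?; apply/andP; split; lra.
have open_unit (z : R) : 0 < z -> z < 1 -> unitI z by move=> ? ?; rewrite /unitI !ltW.
have between (lo hi z w : R) : `|z - w| < w - lo -> `|z - w| < hi - w -> lo < z < hi.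
  by rewrite !ltr_norml => /andP[? ?] /andP[? ?]; apply/andP; split; lra.
pose F j x y : option 'cV[R]_2 :=
  if 0 < y < 1 then
    if (j == i) && (a < x) then Some (vec x y) else
    if (j == sh i) && (x < a) then Some (vec (x + 1) y) else None
  else None.
have [|| p pE] := @lift_glued R N sh sv _ F.
- move=> j y _; rewrite /F a1 a0 !andbT (ltNge a 0) (ltW a0) andbF (inj_eq perm_inj).
  rewrite (ltNge 1 a) (ltW a1) andbF add0r.
  by case: ifP => // _; case: (j == i).
- by move=> j x _; rewrite /F ltxx andbF ltxx.
have FP j x y v : unitI x -> F j x y = Some v ->
  [/\ a < v 0 0, v 0 0 < 1 + a, 0 < v 1 0, v 1 0 < 1 &
   [/\ j = i, a < x & v = vec x y] \/ [/\ j = sh i, x < a & v = vec (x + 1) y]].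
  rewrite /unitI /F => /andP[x0 x1]; case: ifP => // /andP[y0 y1].
  case: ifP => [/andP[/eqP -> ax] [<-]|_].
    by rewrite vec0 vec1; split => //; [lra|left].
  case: ifP => // /andP[/eqP -> ax] [<-].
  by rewrite vec0 vec1; split => //; [lra|lra|right].
pose g (w : 'cV[R]_2) := if w 0 0 <= 1 then sq sh sv i (w 0 0) (w 1 0)
                         else sq sh sv (sh i) (w 0 0 - 1) (w 1 0).
have gp b v : p b = Some v -> g v = b.
  have [j [x [y [Ix Iy ->]]]] := sq_surj b; rewrite pE //.
  case/andP: (Ix) => x0 x1.
  move/(FP _ _ _ _ Ix) => [_ _ _ _ [[-> _ ->]|[-> _ ->]]]; rewrite /g vec0 vec1; first by rewrite x1.
  case: leP => h; last by rewrite addrK.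
  have -> : x = 0 by lra.
  by rewrite add0r sq_right.
have pg (w : 'cV[R]_2) : a < w 0 0 < 1 + a -> 0 < w 1 0 < 1 -> p (g w) = Some w.
  move=> /andP[w0 w0'] /andP[w1 w1'].
  have Iw1 : unitI (w 1 0) by exact: open_unit.
  rewrite /g; case: leP => h.
    by rewrite pE ?(left_unit (w 0 0)) // /F w1 w1' eqxx w0 -vec_eta.
  rewrite pE ?(right_unit (w 0 0)) ?(ltW h) //.
  rewrite /F w1 w1' eqxx /=; case: ifP => [/andP[_ h']|_]; first by exfalso; lra.
  have -> : w 0 0 - 1 < a by lra.
  by rewrite subrK -vec_eta.
pose U : set (glued_space R sh sv) := [set b | p b].
pose phi (b : glued_space R sh sv) := odflt 0 (p b).
have pU b : U b -> p b = Some (phi b) by rewrite /U /phi /=; case: (p b).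
have near_y y : 0 < y < 1 -> forall x, near_in x y (fun _ y' => 0 < y' < 1).
  move=> /andP[y0 y1] x; exists (Num.min y (1 - y)); first by rewrite lt_min y0; lra.
  move=> x' y' _ _ _; rewrite lt_min ltr_norml => /andP[/andP[h _]].
  by rewrite ltr_norml => /andP[_ h']; apply/andP; split; lra.
have near_a x y : a < x -> near_in x y (fun x' _ => a < x').
  move=> ax; exists (x - a); first by rewrite subr_gt0.
  by move=> x' y' _ _; rewrite ltr_norml => /andP[? ?] _; lra.
have near_b x y : x < a -> near_in x y (fun x' _ => x' < a).
  move=> ax; exists (a - x); first by rewrite subr_gt0.
  by move=> x' y' _ _; rewrite ltr_norml => /andP[? ?] _; lra.
have Ft j x y v : unitI x -> F j x y = Some v ->
    near_in x y (fun x' y' => F j x' y' = Some (v + vec (x' - x) (y' - y))).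
  move=> Ix FE; have [_ _ v1 v1' H] := FP _ _ _ _ Ix FE.
  have hy : 0 < y < 1 by case: H => -[_ _ vE]; move: v1 v1'; rewrite vE vec1 => -> ->.
  case: H => -[-> ax ->].
    apply: near_inS (near_inI (near_y _ hy x) (near_a _ y ax)) => x' y' _ _ [hy' hx'].
    rewrite /F hy' eqxx hx' /=; congr Some.
    by apply: vecP; rewrite !mxE /=; ring.
  apply: near_inS (near_inI (near_y _ hy x) (near_b _ y ax)) => x' y' _ _ [hy' hx'].
  rewrite /F hy' eqxx hx' /= (ltNge a) (ltW hx') andbF; congr Some.
  by apply: vecP; rewrite !mxE /=; ring.
exists U, phi; split.
- apply/square_chartP; split.
  + apply/open_sqP => j x y Ix Iy; rewrite /U /= pE //.
    case E : (F j x y) => [v|] // _.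
    by apply: near_inS (Ft _ _ _ _ Ix E) => x' y' Ix' Iy'; rewrite pE // => ->.
  + move=> b c; rewrite !inE => /pU /gp {2}<- /pU /gp {2}<-.
    by move=> ->.
  + move=> V oV VU; rewrite openE => _ [b Vb <-].
    have pb := pU _ (VU _ Vb); set w := phi b in pb *.
    have [w0 w0' w1 w1'] : [/\ a < w 0 0, w 0 0 < 1 + a, 0 < w 1 0 & w 1 0 < 1].
      have [j [x [y [Ix Iy bE]]]] := sq_surj b.
      by move: pb; rewrite bE pE // => /FP[].
    have Vg : V (g w) by rewrite (gp _ _ pb).
    have Iw1 := open_unit _ w1 w1'.
    have [e e0 eV] : exists2 e, 0 < e & forall q : 'cV[R]_2, a < q 0 0 < 1 + a ->
      0 < q 1 0 < 1 -> `|q 0 0 - w 0 0| < e -> `|q 1 0 - w 1 0| < e -> V (g q).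
      have Wl : w 0 0 <= 1 -> near_in (w 0 0) (w 1 0) (fun x' y' => V (sq sh sv i x' y')).
        move=> h; apply: (open_sqP V).1 => //; first exact: left_unit.
        by move: Vg; rewrite /g h.
      have Wr : 1 <= w 0 0 -> near_in (w 0 0 - 1) (w 1 0) (fun x' y' => V (sq sh sv (sh i) x' y')).
        move=> h; apply: (open_sqP V).1 => //; first exact: right_unit.
        move: Vg; rewrite /g; case: leP => // h'.
        have -> : w 0 0 = 1 by apply/eqP; rewrite eq_le h' h.
        by rewrite subrr sq_right.
      have [h|h|h] := ltgtP (w 0 0) 1.
      - have [e e0 eV] := Wl (ltW h).
        exists (Num.min e (1 - w 0 0)); first by rewrite lt_min e0 subr_gt0.
        move=> q /andP[q0 q0'] /andP[q1 q1']; rewrite !lt_min => /andP[? hq] /andP[? _].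
        have hq' : q 0 0 <= 1.
          by rewrite ltW // -(ltrD2r (- w 0 0)) (le_lt_trans (ler_norm _)).
        by rewrite /g hq'; apply: eV => //; [exact: left_unit|exact: open_unit].
      - have [e e0 eV] := Wr (ltW h).
        exists (Num.min e (w 0 0 - 1)); first by rewrite lt_min e0 subr_gt0.
        move=> q /andP[q0 q0'] /andP[q1 q1']; rewrite !lt_min => /andP[hq hq2] /andP[? _].
        have hq' : 1 < q 0 0.
          by rewrite -ltrN2 -(ltrD2l (w 0 0)) (le_lt_trans (ler_norm _)) // distrC.
        rewrite /g leNgt hq' /=; apply: eV => //; [exact: right_unit (ltW hq') q0'|exact: open_unit|].
        by rewrite opprB addrA subrK.
      - have [|e e0 eV] := Wl; first by rewrite h.
        have [|d d0 dV] := Wr; first by rewrite h.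
        exists (Num.min e d); first by rewrite lt_min e0.
        move=> q /andP[q0 q0'] /andP[q1 q1']; rewrite !lt_min => /andP[? ?] /andP[? ?].
        rewrite /g; case: leP => hq; first by apply: eV => //; [exact: left_unit|exact: open_unit].
        apply: dV => //; [exact: right_unit (ltW hq) q0'|exact: open_unit|].
        by rewrite opprB addrA subrK.
    apply/nbhs_vecP.
    exists (Num.min (Num.min e (Num.min (w 0 0 - a) (1 + a - w 0 0)))
              (Num.min (w 1 0) (1 - w 1 0))).
      by rewrite !lt_min e0 !subr_gt0 w0 w0' w1.
    move=> q; rewrite !lt_min => /andP[/andP[q0e /andP[q0a q0b]] _].
    move=> /andP[/andP[q1e _] /andP[q1a q1b]].
    have hq0 : a < q 0 0 < 1 + a by exact: between q0a q0b.
    have hq1 : 0 < q 1 0 < 1 by apply: between q1b; rewrite subr0.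
    by exists (g q); [exact: eV|rewrite /phi pg].
  + move=> j x y Ix Iy; rewrite /U /phi /= pE //.
    case E : (F j x y) => [v|] // _ /=.
    by apply: near_inS (Ft _ _ _ _ Ix E) => x' y' Ix' Iy'; rewrite pE // => ->.
- move=> x y /andP[ax x1] hy; rewrite /U /= pE ?/F ?hy ?eqxx ?ax //.
    by apply/andP; split; lra.
  by case/andP: hy => ? ?; apply/andP; split; lra.
- move=> x y /andP[x0 xa] hy; rewrite /U /= pE ?/F ?hy ?eqxx ?xa //; first by case: ifP.
    by apply/andP; split; lra.
  by case/andP: hy => ? ?; apply/andP; split; lra.
Qed.

(** On the left edge of [i], the strip has to start in the left neighbour. *)
Lemma regular_row sh sv i x y :
  unitI x -> 0 < y < 1 -> regular (sq sh sv i x y).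
Proof.
move=> Ix hy; case/andP: (Ix) => x0 x1.
have [xE|x0'] := eqVneq x 0.
  have [|U [phi [c _ r]]] := @strip_chart sh sv (sh^-1%g i) 2^-1; first by apply/andP; split; lra.
  exists U, phi; split => //; have := r x y; rewrite permKV; apply => //.
  by rewrite xE lexx; lra.
have xp : 0 < x by rewrite lt_neqAle eq_sym x0'.
have [|U [phi [c r _]]] := @strip_chart sh sv i (x / 2); first by apply/andP; split; lra.
by exists U, phi; split => //; apply: r => //; apply/andP; split; lra.
Qed.

(** A quarter turn exchanges the horizontal and the vertical edges. *)
Lemma regular_column sh sv i x y :
  0 < x < 1 -> unitI y -> regular (sq sh sv i x y).
Proof.
move=> hx Iy; have [f [g [fK gK fA gA fE]]] := rotate_maps R sh sv.
have Ix : unitI x by case/andP: hx => ? ?; rewrite /unitI !ltW.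
have [U [phi [c Uf]]] := @regular_row sv^-1%g sh i (1 - y) x (unitI_compl Iy) hx.
have uA : (mx2 0 (-1) 1 0 : 'M[R]_2) \in unitmx.
  apply: (proj1 (@mulmx1_unit _ _ _ (mx2 0 1 (-1) 0) _)).
  by rewrite mulmx2 -mx2_1; congr mx2; ring.
have c' := affine_chart fA fK gK (affine_continuous gA) uA c.
by exists (f @^-1` U), (fun b => invmx (mx2 0 (-1) 1 0) *m phi (f b)); rewrite /preimage /= fE.
Qed.

(** Away from the horizontal edges, replacing a point of a right edge by the one
    glued to it is a normal form that no gluing changes. *)
Lemma sq_inj_row sh sv i j x y :
  0 <= x < 1 -> 0 < y < 1 -> sq sh sv i x y = sq sh sv j x y -> i = j.
Proof.
move=> /andP[x0 x1] /andP[y0 y1].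
have [|| p pE] := @lift_glued R N sh sv _ (fun i x y =>
  if 0 < y < 1 then Some (if x == 1 then (sh i) else i) else None).
- by move=> k z _; rewrite eqxx eq_sym oner_eq0.
- by move=> k z _; rewrite !ltxx andbF.
have Ix : unitI x by rewrite /unitI x0 ltW.
have Iy : unitI y by rewrite /unitI !ltW.
by move/(congr1 p); rewrite !pE // y0 y1 lt_eqF // => -[].
Qed.

Lemma sq_inj_column sh sv i j x y :
  0 < x < 1 -> 0 <= y < 1 -> sq sh sv i x y = sq sh sv j x y -> i = j.
Proof.
move=> /andP[x0 x1] /andP[y0 y1].
have [|| p pE] := @lift_glued R N sh sv _ (fun i x y =>
  if 0 < x < 1 then Some (if y == 1 then (sv i) else i) else None).
- by move=> k z _; rewrite !ltxx andbF.
- by move=> k z _; rewrite eqxx eq_sym oner_eq0.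
have Ix : unitI x by rewrite /unitI !ltW.
have Iy : unitI y by rewrite /unitI y0 ltW.
by move/(congr1 p); rewrite !pE // x0 x1 lt_eqF // => -[].
Qed.

End RegularPoints.

Section SingularPoints.
Variables (R : realType) (N : nat).
Implicit Types (x y : R) (i j : 'I_N) (sh sv : {perm 'I_N}).
Local Hint Resolve unitI0 unitI1 : core.

(** Going once around the lower left corner of [i] leads from [i] to a
    different square, so the points of these two squares just inside the corner
    compete for the same coordinates. *)
Lemma singular_corner sh sv i :
  sv (sh (sv^-1%g (sh^-1%g i))) != i -> ~ regular (sq sh sv i (0 : R) 0).
Proof.
set j := sv _ => ji [U [phi [/square_chartP[oU iU _ tU] Ui]]].
have ijE : sq sh sv j (0 : R) 0 = sq sh sv i 0 0.
  rewrite /j -sq_top // -sq_right //.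
  by rewrite sq_top // permKV sq_right // permKV.
have Uj : U (sq sh sv j 0 0) by rewrite ijE.
have Hi := near_inI ((open_sqP U).1 oU _ _ _ (unitI0 R) (unitI0 R) Ui)
  (tU _ _ _ (unitI0 R) (unitI0 R) Ui).
have Hj := near_inI ((open_sqP U).1 oU _ _ _ (unitI0 R) (unitI0 R) Uj)
  (tU _ _ _ (unitI0 R) (unitI0 R) Uj).
have [e e0 eP] := near_inI Hi Hj.
pose t := Num.min (e / 2) 2^-1.
have t0 : 0 < t by rewrite /t lt_min; apply/andP; split; lra.
have te : t < e by rewrite /t gt_min; apply/orP; left; lra.
have t1 : t < 1 by rewrite /t gt_min; apply/orP; right; lra.
have It : unitI t by rewrite /unitI !ltW.
have tn : `|t - 0| < e by rewrite subr0 gtr0_norm.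
have [[U1 p1] [U2 p2]] := eP t t It It tn tn.
have /sq_inj_row : sq sh sv i t t = sq sh sv j t t.
  by apply: iU; rewrite ?inE // p1 p2 ijE.
rewrite (ltW t0) t0 t1 => /(_ isT isT) ijE'.
by rewrite ijE' eqxx in ji.
Qed.

End SingularPoints.

(** * The covering of the torus *)

Section Developing.
Variable R : realType.
Local Hint Resolve unitI0 unitI1 : core.

Definition int_vec (u : 'cV[R]_2) : Prop :=
  u 0 0 \is a Num.int /\ u 1 0 \is a Num.int.

Lemma int_vecD u v : int_vec u -> int_vec v -> int_vec (u + v).
Proof. by move=> [? ?] [? ?]; split; rewrite mxE rpredD. Qed.

Lemma int_vecN u : int_vec u -> int_vec (- u).
Proof. by move=> [? ?]; split; rewrite mxE rpredN. Qed.

Lemma int_limit (c : R) :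
  (forall e, 0 < e -> exists2 z, z \is a Num.int & `|c - z| < e) ->
  c \is a Num.int.
Proof.
move=> H; set n := (Num.floor c)%:~R : R.
have /andP[nc cn] : n <= c < n + 1.
  by have := real_floor_itv (num_real c); rewrite intrD.
have nZ : n \is a Num.int by rewrite intr_int.
have [ncE|nc'] := eqVneq n c; first by rewrite -ncE.
have ltnc : n < c by rewrite lt_neqAle nc'.
have [|z zZ] := H (Num.min (c - n) (n + 1 - c)); first by rewrite lt_min !subr_gt0 ltnc.
rewrite lt_min => /andP[]; rewrite !ltr_norml => /andP[? ?] /andP[? ?].
have : n < z by lra.
have : z < n + 1 by lra.
case/intrP: zZ => m ->; rewrite /n -[X in _ + X]/(1%:~R) -intrD !ltr_int.
by rewrite ltzD1 => /le_lt_trans h /h; rewrite ltxx.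
Qed.

Lemma connected_locally_constant (E : set R) (P : R -> Prop) t0 :
  connected E -> E t0 -> P t0 ->
  (forall t, E t -> exists2 e, 0 < e & forall s, E s -> `|s - t| < e ->
     (P s <-> P t)) ->
  forall t, E t -> P t.
Proof.
move=> cE Et0 Pt0 loc t Et.
pose nb (Q : R -> Prop) : set R := [set s | exists2 r, E r /\ Q r &
  exists2 e, 0 < e & `|s - r| < e /\
    forall s, E s -> `|s - r| < e -> (P s <-> P r)].
have onb Q : open (nb Q).
  rewrite openE => s [r Qr [e e0 [sr eP]]].
  apply/nbhs_ballP; exists (e - `|s - r|); first by rewrite /= subr_gt0.
  move=> s' /=; rewrite /ball /= => hs; exists r => //; exists e => //; split => //.
  have -> : s' - r = - (s - s') + (s - r) by ring.
  by apply: le_lt_trans (ler_normD _ _) _; rewrite normrN; lra.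
suff [] : (E `&` P) t by [].
rewrite (cE (E `&` P)) //; first by exists t0.
- exists (nb P) => //; apply/seteqP; split=> [s [Es Ps]|s [Es [r [Er Pr] [e e0 [sr eP]]]]].
    split=> //; have [e e0 eP] := loc s Es; exists s => //; exists e => //.
    by rewrite subrr normr0.
  by split => //; apply/(eP s).
- exists (~` nb (fun r => ~ P r)); first by rewrite closedC.
  apply/seteqP; split=> [s [Es Ps]|s [Es nbs]].
    by split => // -[r [Er Pr] [e e0 [sr eP]]]; apply: Pr; apply/(eP s).
  split => //; apply: contrapT => Ps; apply: nbs.
  have [e e0 eP] := loc s Es; exists s => //; exists e => //.
  by rewrite subrr normr0.
Qed.

Lemma dist_shift (e z w c s : R) :
  `|z - w| < e / 2 -> `|s| < e / 2 -> `|w - c - (z - (c + s))| < e.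
Proof. by rewrite !ltr_norml => /andP[? ?] /andP[? ?]; apply/andP; split; lra. Qed.

Section LiesOver.
Variables (N : nat) (sh sv : {perm 'I_N}).
Local Notation X := (glued_space R sh sv).

(** The surface covers the torus R^2/Z^2 away from the vertices; [lies_over b u]
    says that [b] is sent to the class of [u]. *)
Definition lies_over (b : X) (u : 'cV[R]_2) : Prop :=
  exists i x y, [/\ unitI x, unitI y, b = sq sh sv i x y & int_vec (u - vec x y)].

Lemma lies_overE i x y u : unitI x -> unitI y ->
  lies_over (sq sh sv i x y) u <-> int_vec (u - vec x y).
Proof.
move=> Ix Iy; split=> [|h]; last by exists i, x, y.
have shift (z : R) : (z - 1 \is a Num.int) = (z - 0 \is a Num.int).
  by rewrite subr0 rpredBr // rpred1.
have [|| p pE] := @lift_glued R N sh sv _ (fun (_ : 'I_N) x y =>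
  (fun u => int_vec (u - vec x y))).
- move=> _ z _; apply/funext => v; rewrite /int_vec !mxE /=.
  by rewrite shift.
- move=> _ z _; apply/funext => v; rewrite /int_vec !mxE /=.
  by rewrite shift.
case=> j [x' [y' [Ix' Iy' /(congr1 p)]]]; rewrite !pE //.
by move=> /(congr1 (fun h => h u)) /= ->.
Qed.

Lemma lies_over_ex b : exists u, lies_over b u.
Proof.
have [i [x [y [Ix Iy ->]]]] := sq_surj b; exists (vec x y).
by apply/lies_overE => //; rewrite subrr /int_vec !mxE rpred0.
Qed.

Lemma lies_over_diff b u v : lies_over b u -> lies_over b v -> int_vec (u - v).
Proof.
move=> [i [x [y [Ix Iy -> hu]]]] /(lies_overE _ _ Ix Iy) hv.
have -> : u - v = (u - vec x y) + - (v - vec x y) by rewrite opprB addrA subrK.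
by apply: int_vecD => //; apply: int_vecN.
Qed.

Lemma lies_over_shift b u v : lies_over b u -> int_vec (v - u) -> lies_over b v.
Proof.
move=> [i [x [y [Ix Iy -> hu]]]] hvu; apply/lies_overE => //.
by rewrite -(subrK u v) -addrA; apply: int_vecD.
Qed.

Lemma lies_over_near b w (e : R) : 0 < e -> lies_over b w ->
  exists V : set X, [/\ open V, V b & forall c, V c -> exists v,
    [/\ lies_over c v, `|v 0 0 - w 0 0| < e & `|v 1 0 - w 1 0| < e]].
Proof.
move=> e0 bw; exists [set c | exists v,
    [/\ lies_over c v, `|v 0 0 - w 0 0| < e & `|v 1 0 - w 1 0| < e]].
split => //; last by exists w; rewrite !subrr normr0.
apply/open_sqP => i x y Ix Iy [v [/(lies_overE _ _ Ix Iy) hv v0 v1]].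
exists (Num.min (e - `|v 0 0 - w 0 0|) (e - `|v 1 0 - w 1 0|)).
  by rewrite lt_min !subr_gt0 v0.
move=> x' y' Ix' Iy'; rewrite !lt_min => /andP[hx _] /andP[_ hy].
exists (v + (vec x' y' - vec x y)); split.
- by apply/lies_overE => //; rewrite addrA addrAC addrK.
- rewrite !mxE /= addrAC; apply: le_lt_trans (ler_normD _ _) _; lra.
- rewrite !mxE /= addrAC; apply: le_lt_trans (ler_normD _ _) _; lra.
Qed.

(** Every point other than a vertex has a chart, and the vertices are sent to the
    origin of the torus. *)
Lemma singular_lies_over b : ~ regular b -> lies_over b 0.
Proof.
have [i [x [y [Ix Iy ->]]]] := sq_surj b => nreg.
have bd z : unitI z -> ~ (0 < z < 1) -> z \is a Num.int.
  move=> /andP[z0 z1] nz; have [->|z0'] := eqVneq z 0; first exact: rpred0.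
  have [->|z1'] := eqVneq z 1; first exact: rpred1.
  by case: nz; rewrite !lt_neqAle z0 z1 z1' eq_sym z0'.
apply/lies_overE => //; split; rewrite !mxE /= sub0r rpredN; apply: bd => // h;
  apply: nreg; [exact: regular_column|exact: regular_row].
Qed.

End LiesOver.

Section AffineHomeo.
Variables (N M : nat) (sh sv : {perm 'I_N}) (sh' sv' : {perm 'I_M}).
Variable A : 'M[R]_2.
Variables (f : glued_space R sh sv -> glued_space R sh' sv')
          (g : glued_space R sh' sv' -> glued_space R sh sv).
Hypotheses (fK : cancel f g) (cf : continuous f).
Hypothesis fC : forall U phi, square_chart U phi <->
  exists2 psi, square_chart (f @^-1` U) psi & phi \o f = (fun b => A *m psi b).
Local Notation sqX := (sq sh sv).

Lemma iso_regular b : regular (f b) <-> regular b.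
Proof.
split=> [[U [phi [/fC[psi c _] Ub]]]|[U [psi [c Ub]]]]; first by exists (f @^-1` U), psi.
exists (g @^-1` U), (fun c => A *m psi (g c)); split; last by rewrite /preimage /= fK.
apply/fC; exists psi; last by apply/funext => x /=; rewrite fK.
by rewrite -comp_preimage (_ : g \o f = id) ?preimage_id //; exact/funext.
Qed.

(** In a chart at [f b], both [f] and the covering of the torus are affine. *)
Lemma lies_over_image_near i x y u : unitI x -> unitI y ->
  regular (sqX i x y) -> lies_over (f (sqX i x y)) u ->
  near_in x y (fun x' y' =>
    lies_over (f (sqX i x' y')) (u + A *m vec (x' - x) (y' - y))).
Proof.
move=> Ix Iy /iso_regular[U [phi [cU Uf]]] fu.
have /fC[psi cpsi phiE] := cU.
have phifE b : phi (f b) = A *m psi b by exact: (congr1 (fun h => h b) phiE).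
move/square_chartP: cU => [oU _ _ tU]; move/square_chartP: cpsi => [_ _ _ tpsi].
set b := sqX i x y in Uf fu *.
pose V : set (glued_space R sh' sv') := [set c | U c /\ lies_over c (u + (phi c - phi (f b)))].
have oV : open V.
  apply/open_sqP => j x0 y0 Ix0 Iy0 [Uc /(lies_overE _ _ _ _ Ix0 Iy0) hc].
  have := near_inI ((open_sqP U).1 oU _ _ _ Ix0 Iy0 Uc) (tU _ _ _ Ix0 Iy0 Uc).
  apply: near_inS => x' y' Ix' Iy' [Uc' E']; split => //; rewrite E'; apply/lies_overE => //.
  rewrite [X in int_vec X](_ : _ = u + (phi (sq sh' sv' j x0 y0) - phi (f b)) - vec x0 y0) //.
  by apply: vecP; rewrite !mxE /=; ring.
have ofV : open (f @^-1` V) by move/continuousP: cf; apply.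
have Vb : (f @^-1` V) b by split => //; rewrite subrr addr0.
have := near_inI ((open_sqP _).1 ofV _ _ _ Ix Iy Vb) (tpsi _ _ _ Ix Iy Uf).
apply: near_inS => x' y' Ix' Iy' [[_ +] tE].
by rewrite !phifE tE mulmxDr [_ + A *m vec _ _]addrC addrK.
Qed.

Section Path.
Variables (i : 'I_N) (x0 y0 dx dy : R).
Hypotheses (dx1 : `|dx| <= 1) (dy1 : `|dy| <= 1).
Let px t := x0 + t * dx.
Let py t := y0 + t * dy.

(** The offset between the image of a straight path and the straight path in
    direction [A d] is locally constant modulo the lattice. *)
Lemma lies_over_path (E : set R) t0 w : connected E -> E t0 ->
  (forall t, E t -> [/\ unitI (px t), unitI (py t) & regular (sqX i (px t) (py t))]) ->
  lies_over (f (sqX i (px t0) (py t0))) (w + t0 *: (A *m vec dx dy)) ->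
  forall t, E t -> lies_over (f (sqX i (px t) (py t))) (w + t *: (A *m vec dx dy)).
Proof.
move=> cE Et0 reg h0; apply: (connected_locally_constant cE Et0 h0) => t Et.
have [Ix Iy rt] := reg t Et.
have [u hu] := lies_over_ex (f (sqX i (px t) (py t))).
have [e e0 eP] := lies_over_image_near Ix Iy rt hu.
exists e => // s Es hs; have [Ix' Iy' _] := reg s Es.
have small (d z : R) : `|d| <= 1 -> `|z + s * d - (z + t * d)| < e.
  move=> d1; rewrite opprD addrACA subrr add0r -mulrBl normrM.
  by apply: le_lt_trans hs; rewrite ler_piMr.
have := eP _ _ Ix' Iy' (small _ _ dx1) (small _ _ dy1).
have -> : vec (px s - px t) (py s - py t) = (s - t) *: vec dx dy.
  by apply: vecP; rewrite !mxE /= /px /py; ring.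
rewrite -scalemxAr; set v := A *m vec dx dy => hs'.
have key : u + (s - t) *: v - (w + s *: v) = u - (w + t *: v).
  by apply: vecP; rewrite !mxE; ring.
split=> h.
  have := lies_over_diff hs' h; rewrite key => hi.
  apply: lies_over_shift hu _; rewrite -opprB; exact: int_vecN.
have := lies_over_diff hu h; rewrite -key => hi.
apply: lies_over_shift hs' _; rewrite -opprB; exact: int_vecN.
Qed.

(** The start of the ray may be singular; the offset, constant along the ray, is
    found there as a limit. *)
Lemma lies_over_ray w : unitI x0 -> unitI y0 ->
  (forall t, 0 < t < 1 -> [/\ unitI (px t), unitI (py t) & regular (sqX i (px t) (py t))]) ->
  lies_over (f (sqX i x0 y0)) w ->
  forall t, 0 < t < 1 -> lies_over (f (sqX i (px t) (py t))) (w + t *: (A *m vec dx dy)).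
Proof.
move=> Ix0 Iy0 reg hw; set v := A *m vec dx dy.
have cE : connected [set t : R | 0 < t < 1].
  by apply/connected_intervalP => a b /= /andP[a0 a1] /andP[b0 b1] c /andP[ac cb];
     rewrite (lt_le_trans a0 ac) (le_lt_trans cb b1).
have h12 : 0 < (2^-1 : R) < 1 by apply/andP; split; lra.
have [u hu] := lies_over_ex (f (sqX i (px 2^-1) (py 2^-1))).
pose c := u - 2^-1 *: v.
have hc : forall t, 0 < t < 1 -> lies_over (f (sqX i (px t) (py t))) (c + t *: v).
  by apply: (lies_over_path cE h12 reg); rewrite -/v /c subrK.
clearbody c.
suff cw : int_vec (w - c).
  move=> t ht; apply: lies_over_shift (hc t ht) _.
  by rewrite opprD addrACA subrr addr0.
suff H e : 0 < e -> exists z, [/\ int_vec z, `|w 0 0 - c 0 0 - z 0 0| < e & `|w 1 0 - c 1 0 - z 1 0| < e].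
  split; rewrite !mxE; apply: int_limit => e /H[z [[z0 z1] ? ?]].
    by exists (z 0 0).
  by exists (z 1 0).
move=> e0; have e20 : 0 < e / 2 by lra.
have [V [oV Vb VP]] := lies_over_near e20 hw.
have ofV : open (f @^-1` V) by move/continuousP: cf; apply.
have [d d0 dP] := (open_sqP _).1 ofV _ _ _ Ix0 Iy0 Vb.
have [d' d'0 d'P] := mulmx_small A e20.
pose t := Num.min (Num.min d d') 1 / 2.
have m0 : 0 < Num.min (Num.min d d') 1 by rewrite !lt_min d0 d'0 ltr01.
have t0 : 0 < t by rewrite /t; lra.
have : t < Num.min (Num.min d d') 1 by rewrite /t; lra.
rewrite !lt_min => /andP[/andP[td td'] t1].
have ht : 0 < t < 1 by rewrite t0.
have [Ixt Iyt _] := reg t ht.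
have small (z : R) : `|z| <= 1 -> `|t * z| <= t.
  by move=> z1; rewrite normrM (gtr0_norm t0) ler_piMr // ltW.
have [|v' [fv' v'0 v'1]] := VP (f (sqX i (px t) (py t))).
  apply: dP => //; rewrite /px /py addrAC subrr add0r.
    exact: le_lt_trans (small _ dx1) td.
  exact: le_lt_trans (small _ dy1) td.
have [|| tv0 tv1] := d'P (t * dx) (t * dy).
- exact: le_lt_trans (small _ dx1) td'.
- exact: le_lt_trans (small _ dy1) td'.
have tvE : A *m vec (t * dx) (t * dy) = t *: v.
  by rewrite /v scalemxAr; congr (_ *m _); apply: vecP; rewrite !mxE.
rewrite tvE in tv0 tv1; clear tvE; clearbody v; exists (v' - (c + t *: v)); split.
- exact: lies_over_diff fv' (hc t ht).
- by move: tv0; rewrite !mxE; exact: dist_shift v'0.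
- by move: tv1; rewrite !mxE; exact: dist_shift v'1.
Qed.

End Path.

End AffineHomeo.

End Developing.

(** * Rigidity of affine homeomorphisms *)

Section Rigidity.
Variable R : realType.
Local Hint Resolve unitI0 unitI1 : core.

(** Crossing the edges around the lower left corner of [i] leads to another
    square: the cone angle at this corner exceeds 2 pi. *)
Definition singular N (sh sv : {perm 'I_N}) (i : 'I_N) : bool :=
  sv (sh (sv^-1%g (sh^-1%g i))) != i.

Lemma half_in : 0 < (2^-1 : R) < 1.
Proof. by apply/andP; split; lra. Qed.

Lemma unitI_half : unitI (2^-1 : R).
Proof. by apply/andP; split; lra. Qed.
Local Hint Resolve half_in unitI_half : core.

Section EdgeHolonomy.
Variables (N M : nat) (sh sv : {perm 'I_N}) (sh' sv' : {perm 'I_M}).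
Variable A : 'M[R]_2.
Variables (f : glued_space R sh sv -> glued_space R sh' sv')
          (g : glued_space R sh' sv' -> glued_space R sh sv).
Hypotheses (fK : cancel f g) (cf : continuous f).
Hypothesis fC : forall U phi, square_chart U phi <->
  exists2 psi, square_chart (f @^-1` U) psi & phi \o f = (fun b => A *m psi b).

Lemma singular_image i : singular sh sv i -> lies_over (f (sq sh sv i 0 0)) 0.
Proof.
move=> si; apply: singular_lies_over => /(iso_regular fK fC).
exact: singular_corner.
Qed.

(** The lower edge of [i] joins two singular points, so its image is a straight
    path with vector [A e1] from a vertex to a vertex.  Following the edge from
    both ends to its midpoint compares the two vertices modulo the lattice. *)
Lemma row_edge_integral i : singular sh sv i -> singular sh sv (sh i) ->
  int_vec (A *m vec 1 0).
Proof.
move=> si sr.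
have n0 : `|0 : R| <= 1 by rewrite normr0 ler01.
have n1 : `|1 : R| <= 1 by rewrite normr1.
have nN1 : `|-1 : R| <= 1 by rewrite normrN1.
have hl := @lies_over_ray _ _ _ _ _ _ _ _ _ _ fK cf fC i 0 0 1 0 n1 n0 0
  (unitI0 R) (unitI0 R) _ (singular_image si) 2^-1 half_in.
have sr' := singular_image sr; rewrite -sq_right // in sr'.
have hr := @lies_over_ray _ _ _ _ _ _ _ _ _ _ fK cf fC i 1 0 (-1) 0 nN1 n0 0
  (unitI1 R) (unitI0 R) _ sr' 2^-1 half_in.
have e1 : 1 + 2^-1 * -1 = 0 + 2^-1 * 1 :> R by lra.
rewrite e1 in hr.
have -> : A *m vec 1 0 = 0 + 2^-1 *: (A *m vec 1 0) - (0 + 2^-1 *: (A *m vec (-1) 0)).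
  rewrite !add0r !scalemxAr -mulmxBr.
  by congr (_ *m _); apply: vecP; rewrite !mxE /=; lra.
apply: lies_over_diff; [apply: hl|apply: hr] => t /andP[t0 t1]; rewrite mulr0 addr0; split => //.
- by apply/andP; split; lra.
- by apply: regular_column => //; apply/andP; split; lra.
- by apply/andP; split; lra.
- by apply: regular_column => //; apply/andP; split; lra.
Qed.

Lemma column_edge_integral i : singular sh sv i -> singular sh sv (sv i) ->
  int_vec (A *m vec 0 1).
Proof.
move=> si sr.
have n0 : `|0 : R| <= 1 by rewrite normr0 ler01.
have n1 : `|1 : R| <= 1 by rewrite normr1.
have nN1 : `|-1 : R| <= 1 by rewrite normrN1.
have hl := @lies_over_ray _ _ _ _ _ _ _ _ _ _ fK cf fC i 0 0 0 1 n0 n1 0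
  (unitI0 R) (unitI0 R) _ (singular_image si) 2^-1 half_in.
have sr' := singular_image sr; rewrite -sq_top // in sr'.
have hr := @lies_over_ray _ _ _ _ _ _ _ _ _ _ fK cf fC i 0 1 0 (-1) n0 nN1 0
  (unitI0 R) (unitI1 R) _ sr' 2^-1 half_in.
have e1 : 1 + 2^-1 * -1 = 0 + 2^-1 * 1 :> R by lra.
rewrite e1 in hr.
have -> : A *m vec 0 1 = 0 + 2^-1 *: (A *m vec 0 1) - (0 + 2^-1 *: (A *m vec 0 (-1))).
  rewrite !add0r !scalemxAr -mulmxBr.
  by congr (_ *m _); apply: vecP; rewrite !mxE /=; lra.
apply: lies_over_diff; [apply: hl|apply: hr] => t /andP[t0 t1]; rewrite mulr0 addr0; split => //.
- by apply/andP; split; lra.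
- by apply: regular_row => //; apply/andP; split; lra.
- by apply/andP; split; lra.
- by apply: regular_row => //; apply/andP; split; lra.
Qed.

End EdgeHolonomy.

Lemma iso_integral N M (sh sv : {perm 'I_N}) (sh' sv' : {perm 'I_M})
    (A : 'M[R]_2) i j :
  singular sh sv i -> singular sh sv (sh i) ->
  singular sh sv j -> singular sh sv (sv j) ->
  tsurface_iso (sl_act A (square_tiled R sh sv)) (square_tiled R sh' sv') ->
  forall k l, A k l \is a Num.int.
Proof.
move=> si sr sj st [f [g [fK _ cf _ fC]]].
have [h00 h10] := row_edge_integral fK cf fC si sr.
have [h01 h11] := column_edge_integral fK cf fC sj st.
rewrite !mulmx_vec ?vec0 ?vec1 !mulr0 !mulr1 !addr0 !add0r in h00 h10 h01 h11.
by apply: ord2P; apply: ord2P.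
Qed.

Section TranslationHomeo.
Variables (N M : nat) (sh sv : {perm 'I_N}) (sh' sv' : {perm 'I_M}).
Variables (f : glued_space R sh sv -> glued_space R sh' sv')
          (g : glued_space R sh' sv' -> glued_space R sh sv).
Hypotheses (fK : cancel f g) (cf : continuous f).
Hypothesis fC : forall U phi, square_chart U phi <->
  exists2 psi, square_chart (f @^-1` U) psi & phi \o f = (fun b => 1%:M *m psi b).

(** Both sides have the same coordinates in a chart, and a chart is injective. *)
Lemma same_square_near i k x y : unitI x -> unitI y ->
  regular (sq sh sv i x y) -> f (sq sh sv i x y) = sq sh' sv' k x y ->
  near_in x y (fun x' y' => f (sq sh sv i x' y') = sq sh' sv' k x' y').
Proof.
move=> Ix Iy /(iso_regular fK fC)[U [phi [cU Uf]]] fE.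
have /fC[psi cpsi phiE] := cU.
have phifE b : phi (f b) = psi b by rewrite -[RHS]mul1mx; exact: (congr1 (fun h => h b) phiE).
move/square_chartP: cU => [oU iU _ tU]; move/square_chartP: cpsi => [oV _ _ tpsi].
have Ufk := Uf; rewrite fE in Ufk.
have H := near_inI ((open_sqP _).1 oV _ _ _ Ix Iy Uf) (tpsi _ _ _ Ix Iy Uf).
have H' := near_inI ((open_sqP _).1 oU _ _ _ Ix Iy Ufk) (tU _ _ _ Ix Iy Ufk).
apply: near_inS (near_inI H H') => x' y' _ _ [[U1 p1] [U2 p2]].
by apply: iU; rewrite ?inE // p2 phifE p1 -phifE fE.
Qed.

(** In the interior of a square the label of the image square is locally constant;
    at the end points, which may lie on an edge, it is determined by the interior
    points nearby. *)
Lemma segment_same_square i x0 y0 dx dy t1 :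
  `|dx| <= 1 -> `|dy| <= 1 ->
  (forall t, 0 <= t <= 1 -> [/\ unitI (x0 + t * dx), unitI (y0 + t * dy) &
      regular (sq sh sv i (x0 + t * dx) (y0 + t * dy))]) ->
  (forall t c, 0 <= t <= 1 ->
     lies_over c (vec (x0 + t * dx) (y0 + t * dy)) ->
     exists k, c = sq sh' sv' k (x0 + t * dx) (y0 + t * dy)) ->
  (forall t k k', 0 < t < 1 -> sq sh' sv' k (x0 + t * dx) (y0 + t * dy) =
     sq sh' sv' k' (x0 + t * dx) (y0 + t * dy) -> k = k') ->
  0 <= t1 <= 1 ->
  lies_over (f (sq sh sv i (x0 + t1 * dx) (y0 + t1 * dy)))
            (vec (x0 + t1 * dx) (y0 + t1 * dy)) ->
  exists k, forall t, 0 <= t <= 1 ->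
    f (sq sh sv i (x0 + t * dx) (y0 + t * dy)) =
    sq sh' sv' k (x0 + t * dx) (y0 + t * dy).
Proof.
move=> dx1 dy1 reg above inner ht1 ht1f.
have pE t : vec (x0 + t * dx) (y0 + t * dy) = vec x0 y0 + t *: (1%:M *m vec dx dy).
  by rewrite mul1mx; apply: vecP; rewrite !mxE.
have cE : connected [set t : R | 0 <= t <= 1].
  by apply/connected_intervalP => a b /= /andP[a0 a1] /andP[b0 b1] c /andP[ac cb];
     rewrite (le_trans a0 ac) (le_trans cb b1).
have cE' : connected [set t : R | 0 < t < 1].
  by apply/connected_intervalP => a b /= /andP[a0 a1] /andP[b0 b1] c /andP[ac cb];
     rewrite (lt_le_trans a0 ac) (le_lt_trans cb b1).
have over t : 0 <= t <= 1 -> exists k, f (sq sh sv i (x0 + t * dx) (y0 + t * dy)) =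
    sq sh' sv' k (x0 + t * dx) (y0 + t * dy).
  move=> ht; apply: above => //; rewrite pE.
  apply: (lies_over_path fK cf fC dx1 dy1 cE ht1 reg _ ht).
  by rewrite -pE.
have near t k : 0 <= t <= 1 -> f (sq sh sv i (x0 + t * dx) (y0 + t * dy)) =
    sq sh' sv' k (x0 + t * dx) (y0 + t * dy) -> exists2 e, 0 < e & forall s,
    0 <= s <= 1 -> `|s - t| < e -> f (sq sh sv i (x0 + s * dx) (y0 + s * dy)) =
    sq sh' sv' k (x0 + s * dx) (y0 + s * dy).
  move=> ht fE; have [Ix Iy rt] := reg t ht.
  have [e e0 eP] := same_square_near Ix Iy rt fE.
  exists e => // s hs st; have [Ix' Iy' _] := reg s hs.
  have small (d z : R) : `|d| <= 1 -> `|z + s * d - (z + t * d)| < e.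
    move=> d1; rewrite opprD addrACA subrr add0r -mulrBl normrM.
    by apply: le_lt_trans st; rewrite ler_piMr.
  by apply: eP => //; exact: small.
have wide (t : R) : 0 < t < 1 -> 0 <= t <= 1 by move=> /andP[? ?]; rewrite !ltW.
have [k kP] := over _ (wide _ half_in).
have kin t : 0 < t < 1 -> f (sq sh sv i (x0 + t * dx) (y0 + t * dy)) =
    sq sh' sv' k (x0 + t * dx) (y0 + t * dy).
  move: t; apply: (@connected_locally_constant R _ (fun t =>
    f (sq sh sv i (x0 + t * dx) (y0 + t * dy)) =
    sq sh' sv' k (x0 + t * dx) (y0 + t * dy)) _ cE' half_in kP) => t ht.
  have [k' k'P] := over t (wide _ ht); have [e e0 eP] := near _ _ (wide _ ht) k'P.
  exists e => // s hs st; have k's := eP s (wide _ hs) st.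
  split=> E; first by rewrite (inner s k k' hs) // -E.
  by rewrite (inner t k k' ht) // -E.
exists k => t ht; have [k' k'P] := over t ht; have [e e0 eP] := near _ _ ht k'P.
(* a small step from [t] towards 1/2 leads to an interior parameter *)
have [s hs st] : exists2 s, 0 < s < 1 & `|s - t| < e.
  have e4 : 0 < Num.min e 1 by rewrite lt_min e0 ltr01.
  have [e4e e41] : Num.min e 1 <= e /\ Num.min e 1 <= 1 by rewrite !ge_min !lexx orbT.
  case/andP: ht => h0 h1; exists (t + (2^-1 - t) * (Num.min e 1)).
    by apply/andP; split; nra.
  rewrite addrC addKr normrM (gtr0_norm e4).
  apply: (@lt_le_trans _ _ (1 * Num.min e 1)); last by rewrite mul1r.
  by rewrite ltr_pM2r // ltr_norml; apply/andP; split; lra.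
have E := kin s hs; rewrite (eP s (wide _ hs) st) in E.
by rewrite k'P (inner _ _ _ hs E).
Qed.

End TranslationHomeo.

Lemma int_diff_unitI (x y : R) : unitI x -> unitI y -> x - y \is a Num.int ->
  [\/ x = y, x = 0 /\ y = 1 | x = 1 /\ y = 0].
Proof.
move=> /andP[x0 x1] /andP[y0 y1] /intrP[m mE].
have lo : (-1)%:~R <= m%:~R :> R by rewrite -mE; lra.
have hi : m%:~R <= 1%:~R :> R by rewrite -mE; lra.
rewrite !ler_int in lo hi.
have [m0|[m0|m0]] : m = 0 \/ m = 1 \/ m = -1 by lia.
- by apply: Or31; move: mE; rewrite m0; lra.
- by apply: Or33; move: mE; rewrite m0; lra.
- by apply: Or32; move: mE; rewrite m0; lra.
Qed.

Lemma over_row_point N (sh sv : {perm 'I_N}) x y (c : glued_space R sh sv) :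
  unitI x -> 0 < y < 1 -> lies_over c (vec x y) -> exists k, c = sq sh sv k x y.
Proof.
move=> Ix hy [j [x' [y' [Ix' Iy' -> []]]]]; rewrite !mxE /= => hx hy'.
have Iy : unitI y by case/andP: hy => ? ?; rewrite /unitI !ltW.
have <- : y = y' by case: (int_diff_unitI Iy Iy' hy') => // -[yE _];
  move: hy; rewrite yE !ltxx ?andbF.
case: (int_diff_unitI Ix Ix' hx) => [->|[-> ->]|[-> ->]]; first by exists j.
  by exists (sh j); rewrite sq_right.
by exists (sh^-1%g j); rewrite sq_right // permKV.
Qed.

Lemma over_column_point N (sh sv : {perm 'I_N}) x y (c : glued_space R sh sv) :
  0 < x < 1 -> unitI y -> lies_over c (vec x y) -> exists k, c = sq sh sv k x y.
Proof.
move=> hx Iy [j [x' [y' [Ix' Iy' -> []]]]]; rewrite !mxE /= => hx' hy.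
have Ix : unitI x by case/andP: hx => ? ?; rewrite /unitI !ltW.
have <- : x = x' by case: (int_diff_unitI Ix Ix' hx') => // -[xE _];
  move: hx; rewrite xE !ltxx ?andbF.
case: (int_diff_unitI Iy Iy' hy) => [->|[-> ->]|[-> ->]]; first by exists j.
  by exists (sv j); rewrite sq_top.
by exists (sv^-1%g j); rewrite sq_top // permKV.
Qed.

(** Translations map squares to squares: near a singular corner the image of a
    square has to lie above the unit square of the torus, this property passes
    through the edges, and the image then stays in one square. *)
Lemma translation_iso_conj N M (sh sv : {perm 'I_N}) (sh' sv' : {perm 'I_M}) i0 :
  singular sh sv i0 ->
  (forall P : 'I_N -> Prop, P i0 -> (forall i, P i -> P (sh i)) ->
     (forall i, P i -> P (sv i)) -> forall i, P i) ->
  tsurface_iso (sl_act 1%:M (square_tiled R sh sv)) (square_tiled R sh' sv') ->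
  exists s : 'I_N -> 'I_M,
    (forall i, s (sh i) = sh' (s i)) /\ (forall i, s (sv i) = sv' (s i)).
Proof.
move=> si0 trans [f [g [fK _ cf _ fC]]].
have n0 : `|0 : R| <= 1 by rewrite normr0 ler01.
have n1 : `|1 : R| <= 1 by rewrite normr1.
pose centered i := lies_over (f (sq sh sv i 2^-1 2^-1)) (vec 2^-1 2^-1 : 'cV[R]_2).
have row i t1 : 0 <= t1 <= 1 -> lies_over (f (sq sh sv i t1 2^-1)) (vec t1 2^-1) ->
    exists k, forall t, 0 <= t <= 1 -> f (sq sh sv i t 2^-1) = sq sh' sv' k t 2^-1.
  move=> ht1 h.
  have E t : 0 + t * 1 = t :> R by rewrite add0r mulr1.
  have E' t : 2^-1 + t * 0 = 2^-1 :> R by rewrite mulr0 addr0.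
  have := @segment_same_square _ _ _ _ _ _ f g fK cf fC i 0 2^-1 1 0 t1 n1 n0.
  rewrite !(E, E') => H.
  have [|||k kP] := H _ _ _ ht1 h.
  - by move=> t ht; rewrite !(E, E'); split => //; apply: regular_row.
  - by move=> t c ht; rewrite !(E, E'); apply: over_row_point.
  - by move=> t k k' /andP[t0 t1']; rewrite !(E, E'); apply: sq_inj_row => //; rewrite (ltW t0).
  by exists k => t ht; have := kP t ht; rewrite !(E, E').
have col i t1 : 0 <= t1 <= 1 -> lies_over (f (sq sh sv i 2^-1 t1)) (vec 2^-1 t1) ->
    exists k, forall t, 0 <= t <= 1 -> f (sq sh sv i 2^-1 t) = sq sh' sv' k 2^-1 t.
  move=> ht1 h.
  have E t : 0 + t * 1 = t :> R by rewrite add0r mulr1.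
  have E' t : 2^-1 + t * 0 = 2^-1 :> R by rewrite mulr0 addr0.
  have := @segment_same_square _ _ _ _ _ _ f g fK cf fC i 2^-1 0 0 1 t1 n0 n1.
  rewrite !(E, E') => H.
  have [|||k kP] := H _ _ _ ht1 h.
  - by move=> t ht; rewrite !(E, E'); split => //; apply: regular_column.
  - by move=> t c ht; rewrite !(E, E'); apply: over_column_point.
  - by move=> t k k' /andP[t0 t1']; rewrite !(E, E'); apply: sq_inj_column => //; rewrite (ltW t0).
  by exists k => t ht; have := kP t ht; rewrite !(E, E').
have h01 : 0 <= (2^-1 : R) <= 1 by exact: unitI_half.
have self k x y : unitI x -> unitI y -> lies_over (sq sh' sv' k x y) (vec x y).
  by move=> Ix Iy; apply/lies_overE => //; rewrite subrr; split; rewrite mxE rpred0.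
have int1 (u v : R) : int_vec (vec 0 v - vec 1 v) /\ int_vec (vec u 0 - vec u 1).
  by split; split; rewrite !mxE /= ?subrr ?sub0r ?rpredN ?rpred0 ?rpred1.
have cen : forall i, centered i.
  apply: trans => [|i ci|i ci].
  - have hray := @lies_over_ray _ _ _ _ _ _ _ _ f g fK cf fC i0 0 0 1 1 n1 n1 0
      (unitI0 R) (unitI0 R) _ (singular_image fK fC si0) 2^-1 half_in.
    have -> : centered i0 = lies_over (f (sq sh sv i0 (0 + 2^-1 * 1) (0 + 2^-1 * 1)))
        (0 + 2^-1 *: (1%:M *m vec 1 1)).
      rewrite /centered !add0r mulr1 mul1mx; congr lies_over.
      by apply: vecP; rewrite !mxE /= mulr1.
    apply: hray => t ht; rewrite !add0r mulr1.
    have It : unitI t by case/andP: ht => ? ?; rewrite /unitI !ltW.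
    by split => //; apply: regular_row.
  - have [k kP] := row i 2^-1 h01 ci.
    have [|k' k'P] := row (sh i) 0 (unitI0 R).
      rewrite -sq_right // kP ?ler01 ?lexx //.
      by apply: (@lies_over_shift _ _ _ _ _ (vec 1 2^-1)); [exact: self|case: (int1 0 2^-1)].
    by rewrite /centered k'P //; apply: self.
  - have [k kP] := col i 2^-1 h01 ci.
    have [|k' k'P] := col (sv i) 0 (unitI0 R).
      rewrite -sq_top // kP ?ler01 ?lexx //.
      by apply: (@lies_over_shift _ _ _ _ _ (vec 2^-1 1)); [exact: self|case: (int1 2^-1 0)].
    by rewrite /centered k'P //; apply: self.
have /choice[s sP] : forall i, exists k, 
    (forall t, 0 <= t <= 1 -> f (sq sh sv i t 2^-1) = sq sh' sv' k t 2^-1) /\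
    (forall t, 0 <= t <= 1 -> f (sq sh sv i 2^-1 t) = sq sh' sv' k 2^-1 t).
  move=> i; have [k kP] := row i 2^-1 h01 (cen i); have [k' k'P] := col i 2^-1 h01 (cen i).
  have kk' : k = k'.
    by apply: (@sq_inj_row _ _ sh' sv' k k' (2^-1 : R) 2^-1); [apply/andP; split; lra| |rewrite -kP // k'P].
  by exists k; split => // t ht; rewrite kk' k'P.
exists s; split=> i.
- apply: (@sq_inj_row _ _ sh' sv' _ _ (0 : R) 2^-1); rewrite ?lexx ?ltr01 //.
  rewrite -(proj1 (sP (sh i))) ?lexx ?ler01 // -!sq_right // (proj1 (sP i)) ?lexx ?ler01 //.
- apply: (@sq_inj_column _ _ sh' sv' _ _ 2^-1 (0 : R)); rewrite ?lexx ?ltr01 //.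
  rewrite -(proj2 (sP (sv i))) ?lexx ?ler01 // -!sq_top // (proj2 (sP i)) ?lexx ?ler01 //.
Qed.

End Rigidity.

(** * The modular group and the rational projective line *)

Section IsoGroup.
Variable R : realType.
Implicit Types X Y Z : tsurface R.

Lemma tsurface_iso_comp X Y Z (A B : 'M[R]_2) :
  tsurface_iso (sl_act A X) Y -> tsurface_iso (sl_act B Y) Z ->
  tsurface_iso (sl_act (B *m A) X) Z.
Proof.
move=> [f1 [g1 [fK1 gK1 cf1 cg1 fC1]]] [f2 [g2 [fK2 gK2 cf2 cg2 fC2]]].
exists (f2 \o f1), (g1 \o g2); split.
- by move=> a /=; rewrite fK2 fK1.
- by move=> a /=; rewrite gK1 gK2.
- by move=> a; apply: continuous_comp; [exact: cf1|exact: cf2].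
- by move=> a; apply: continuous_comp; [exact: cg2|exact: cg1].
move=> U phi; rewrite fC2 /=; split=> [[psi /fC1[chi cchi psiE] phiE]|[chi cchi phiE]].
  exists chi => //; apply/funext => a /=.
  have := congr1 (fun h => h (f1 a)) phiE; have := congr1 (fun h => h a) psiE.
  by rewrite /= => -> ->; rewrite mulmxA.
exists (fun b => A *m chi (g1 b)).
  by apply/fC1; exists chi => //; apply/funext => a /=; rewrite fK1.
apply/funext => b /=; have := congr1 (fun h => h (g1 b)) phiE.
by rewrite /= gK1 => ->; rewrite mulmxA.
Qed.

Lemma tsurface_iso_inv X Y (A : 'M[R]_2) : A \in unitmx ->
  tsurface_iso (sl_act A X) Y -> tsurface_iso (sl_act (invmx A) Y) X.
Proof.
move=> uA [f [g [fK gK cf cg fC]]]; exists g, f; split => // U phi.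
have fgU : f @^-1` (g @^-1` U) = U.
  by rewrite -comp_preimage (_ : g \o f = id) ?preimage_id //; exact/funext.
split=> [cU|[psi /fC[chi]]] /=.
  exists (fun b => A *m phi (g b)); last by apply/funext => b /=; rewrite mulKmx.
  apply/fC; exists phi; first by rewrite fgU.
  by apply/funext => a /=; rewrite fK.
rewrite fgU => cchi psiE phiE; suff -> : phi = chi by [].
apply/funext => a; have := congr1 (fun h => h (f a)) phiE.
have := congr1 (fun h => h a) psiE.
by rewrite /= fK => -> ->; rewrite mulKmx.
Qed.

End IsoGroup.

Section SL2Z.
Local Notation mat := 'M[int]_2.

Lemma mx2_eta (K : pzRingType) (A : 'M[K]_2) : A = mx2 (A 0 0) (A 0 1) (A 1 0) (A 1 1).
Proof. by apply: mx2P; rewrite !mxE. Qed.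

Lemma det_mx2 (K : comPzRingType) (a b c d : K) : \det (mx2 a b c d) = a * d - b * c.
Proof.
rewrite (expand_det_row _ 0) !big_ord_recl big_ord0 /cofactor !det_mx11 !mxE /=.
by rewrite expr0 expr1 addr0 mul1r mulN1r mulrN.
Qed.

Lemma SL2Z_mx2 (a b c d : int) : SL2Z (mx2 a b c d) <-> a * d - b * c = 1.
Proof. by rewrite /SL2Z /= det_mx2. Qed.

Lemma int_mul_eq1 (a d : int) : a * d = 1 -> a = 1 /\ d = 1 \/ a = -1 /\ d = -1.
Proof.
move=> h; have : (`|a| * `|d| = 1)%N by rewrite -abszM h.
move/eqP; rewrite muln_eq1 => /andP[/eqP a1 /eqP d1].
by move: h a1 d1; lia.
Qed.

Lemma SL2Z1 : SL2Z 1%:M. Proof. exact: det1. Qed.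

Lemma SL2ZM (A B : mat) : SL2Z A -> SL2Z B -> SL2Z (A *m B).
Proof. by rewrite /SL2Z /= det_mulmx => -> ->. Qed.

Lemma SL2Z_unit (A : mat) : SL2Z A -> A \in unitmx.
Proof. by rewrite /SL2Z /= unitmxE => ->; rewrite unitr1. Qed.

Lemma SL2ZV (A : mat) : SL2Z A -> SL2Z (invmx A).
Proof. by rewrite /SL2Z /= det_inv => ->; rewrite invr1. Qed.

Lemma invmx2 (a b c d : int) : a * d - b * c = 1 ->
  invmx (mx2 a b c d) = mx2 d (- b) (- c) a.
Proof.
move=> h; have u : mx2 a b c d \in unitmx by apply: SL2Z_unit; apply/SL2Z_mx2.
rewrite -[RHS](mulKmx u) mulmx2.
have -> : mx2 (a * d + b * - c) (a * - b + b * a) (c * d + d * - c) (c * - b + d * a) = 1%:M.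
  by rewrite -mx2_1; congr mx2; rewrite -?h; ring.
by rewrite mulmx1.
Qed.

Definition rotZ : mat := mx2 0 (-1) 1 0.
Definition shearZ : mat := mx2 1 1 0 1.

Lemma SL2Z_rot : SL2Z rotZ. Proof. exact/SL2Z_mx2. Qed.
Lemma SL2Z_shear (m : int) : SL2Z (mx2 1 m 0 1).
Proof. by apply/SL2Z_mx2; rewrite !mulr1 mulr0 subr0. Qed.

(** Euclid's algorithm on the first column. *)
Lemma SL2Z_ind (Q : mat -> Prop) :
  Q 1%:M ->
  (forall g, SL2Z g -> Q g -> Q (shearZ *m g)) ->
  (forall g, SL2Z g -> Q g -> Q (rotZ *m g)) ->
  forall g, SL2Z g -> Q g.
Proof.
move=> Q1 QT QS.
have SS : rotZ *m rotZ = mx2 (-1) 0 0 (-1) by rewrite mulmx2; congr mx2; ring.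
have QN g : SL2Z g -> Q g -> Q (- g).
  move=> sg Qg; have := QS _ (SL2ZM SL2Z_rot sg) (QS _ sg Qg).
  rewrite mulmxA SS; congr Q.
  by rewrite [g in RHS]mx2_eta [g in LHS]mx2_eta mulmx2; apply: mx2P; rewrite !mxE /=; ring.
have shearN g : SL2Z g -> Q g -> Q (mx2 1 (-1) 0 1 *m g).
  move=> sg Qg.
  have s1 := SL2ZM SL2Z_rot sg; have q1 := QS _ sg Qg.
  have s2 := SL2ZM (SL2Z_shear 1) s1; have q2 := QT _ s1 q1.
  have s3 := SL2ZM SL2Z_rot s2; have q3 := QS _ s2 q2.
  have s4 := SL2ZM (SL2Z_shear 1) s3; have q4 := QT _ s3 q3.
  have s5 := SL2ZM SL2Z_rot s4; have q5 := QS _ s4 q4.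
  have := QN _ s5 q5; congr Q.
  rewrite !mulmxA -mulNmx; congr (_ *m g).
  by rewrite !mulmx2; apply: mx2P; rewrite !mxE /=; ring.
have QTn (m : nat) g : SL2Z g -> Q g -> Q (mx2 1 m%:Z 0 1 *m g).
  elim: m g => [|m IH] g sg Qg; first by rewrite mx2_1 mul1mx.
  have := QT _ (SL2ZM (SL2Z_shear _) sg) (IH g sg Qg); congr Q.
  by rewrite mulmxA mulmx2; congr (mx2 _ _ _ _ *m g); lia.
have QTNn (m : nat) g : SL2Z g -> Q g -> Q (mx2 1 (- m%:Z) 0 1 *m g).
  elim: m g => [|m IH] g sg Qg; first by rewrite oppr0 mx2_1 mul1mx.
  have := shearN _ (SL2ZM (SL2Z_shear _) sg) (IH g sg Qg); congr Q.
  by rewrite mulmxA mulmx2; congr (mx2 _ _ _ _ *m g); lia.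
have QTz (m : int) g : SL2Z g -> Q g -> Q (mx2 1 m 0 1 *m g).
  case: m => m sg Qg; first exact: QTn.
  by rewrite NegzE; apply: QTNn.
suff H (k : nat) (a b c d : int) : (`|c| < k)%N -> a * d - b * c = 1 -> Q (mx2 a b c d).
  move=> g sg; rewrite (mx2_eta g); apply: (H `|g 1 0|.+1) => //.
  by rewrite -det_mx2 -mx2_eta.
elim: k a b c d => // k IH a b c d ck detE.
have [c0|c0] := eqVneq c 0.
  rewrite c0 mulr0 subr0 in detE; rewrite c0.
  have QTb := QTz _ _ SL2Z1 Q1; have sb m := SL2ZM (SL2Z_shear m) SL2Z1.
  have [[-> ->]|[-> ->]] : a = 1 /\ d = 1 \/ a = -1 /\ d = -1.
    exact: int_mul_eq1.
    by have := QTb b; rewrite mulmx1.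
  have := QN _ (sb (- b)) (QTb (- b)); congr Q; rewrite mulmx1.
  by apply: mx2P; rewrite !mxE /= ?opprK ?oppr0.
pose q := (a %/ c)%Z.
have aE : a - q * c = (a %% c)%Z by rewrite /q {1}(divz_eq a c) addrC addKr.
have Qg' : Q (mx2 c d (- (a - q * c)) (- (b - q * d))).
  apply: IH; last by rewrite -detE; ring.
  rewrite abszN aE; have := ltz_mod a c0; have := modz_ge0 a c0.
  by move: ck; lia.
have sg' : SL2Z (mx2 c d (- (a - q * c)) (- (b - q * d))).
  by apply/SL2Z_mx2; rewrite -detE; ring.
have := QTz q _ (SL2ZM SL2Z_rot sg') (QS _ sg' Qg'); congr Q.
by rewrite !mulmx2; congr mx2; ring.
Qed.

(** The point of the projective line with homogeneous coordinates [p : q]. *)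
Definition proj_pt (p q : int) : P1Q :=
  if q == 0 then None else Some (p%:~R / q%:~R).

Lemma moebius_proj (a b c d p q : int) :
  a * d - b * c = 1 -> (p != 0) || (q != 0) ->
  moebius (mx2 a b c d) (proj_pt p q) = proj_pt (a * p + b * q) (c * p + d * q).
Proof.
move=> h pq; rewrite /moebius /proj_pt !mxE /=.
have [q0|q0] := eqVneq q 0.
  rewrite q0 eqxx orbF in pq; rewrite q0 !mulr0 !addr0 mulf_eq0 (negPf pq) orbF intr_eq0.
  case: ifPn => // c0; congr Some; rewrite !intrM.
  have p0 : p%:~R != 0 :> rat by rewrite intr_eq0.
  have c0' : c%:~R != 0 :> rat by rewrite intr_eq0.
  by field; rewrite c0' p0.
have q0' : q%:~R != 0 :> rat by rewrite intr_eq0.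
have E (x y : int) : x%:~R * (p%:~R / q%:~R) + y%:~R = (x * p + y * q)%:~R / q%:~R :> rat.
  by rewrite intrD !intrM; field.
rewrite !E mulf_eq0 invr_eq0 (negPf q0') orbF intr_eq0.
case: ifPn => // r0; congr Some.
have r0' : c%:~R * p%:~R + d%:~R * q%:~R != 0 :> rat.
  by rewrite -!intrM -intrD intr_eq0.
by rewrite !(intrD, intrM); field; rewrite q0' r0'.
Qed.

Lemma moebius_infty (g : mat) : moebius g inftyQ = proj_pt (g 0 0) (g 1 0).
Proof. by rewrite /moebius /proj_pt intr_eq0. Qed.

Lemma col0_neq0 (g : mat) : SL2Z g -> (g 0 0 != 0) || (g 1 0 != 0).
Proof.
rewrite (mx2_eta g) => /SL2Z_mx2 h; rewrite !mxE /= -negb_and.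
by apply/negP => /andP[/eqP a0 /eqP c0]; move: h; rewrite a0 c0 mul0r mulr0 subr0.
Qed.

Lemma moebiusM (g h : mat) : SL2Z g -> SL2Z h ->
  moebius (g *m h) inftyQ = moebius g (moebius h inftyQ).
Proof.
move=> sg sh; rewrite !moebius_infty [g in RHS]mx2_eta moebius_proj ?col0_neq0 //.
  by rewrite [g in LHS]mx2_eta [h in LHS]mx2_eta mulmx2 !mxE.
by apply/SL2Z_mx2; rewrite -mx2_eta.
Qed.

Lemma moebiusK (g h : mat) : SL2Z g -> SL2Z h ->
  moebius (invmx g) (moebius g (moebius h inftyQ)) = moebius h inftyQ.
Proof.
move=> sg sh; rewrite -!moebiusM //; try exact: SL2ZV.
  by rewrite mulKmx // SL2Z_unit.
exact: SL2ZM.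
Qed.

(** Bezout coefficients complete numerator and denominator to a matrix. *)
Lemma SL2Z_transitive (x : P1Q) : exists2 g, SL2Z g & moebius g inftyQ = x.
Proof.
case: x => [t|]; last by exists 1%:M; [exact: SL2Z1|rewrite moebius_infty !mxE].
have := coprime_num_den t; rewrite -coprimezE => /coprimezP[[u v] /= uv].
exists (mx2 (numq t) (- v) (denq t) u).
  by apply/SL2Z_mx2; rewrite -uv; ring.
by rewrite !mxE /= intr_eq0 (negPf (denq_neq0 t)) divq_num_den.
Qed.

Lemma stabilizer_infty (g : mat) : SL2Z g -> moebius g inftyQ = inftyQ ->
  exists m, g = mx2 1 m 0 1 \/ g = - mx2 1 m 0 1.
Proof.
rewrite moebius_infty /proj_pt => sg; case: eqP => // c0 _.
have := sg; rewrite (mx2_eta g) => /SL2Z_mx2; rewrite c0 mulr0 subr0 => h.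
have [[a1 d1]|[a1 d1]] : g 0 0 = 1 /\ g 1 1 = 1 \/ g 0 0 = -1 /\ g 1 1 = -1.
  exact: int_mul_eq1.
  by exists (g 0 1); left; rewrite a1 d1.
exists (- g 0 1); right; rewrite a1 d1.
by apply: mx2P; rewrite !mxE /= ?opprK ?oppr0.
Qed.

Lemma transvectionE w : transvection w = mx2 1 w%:Z 0 1.
Proof. by apply: mx2P; rewrite !mxE. Qed.

End SL2Z.

(** * Index, cusps and widths from the action on cosets *)

Lemma flatten_uniq_index (T : eqType) (ss : seq (seq T)) (x : T) i j :
  uniq (flatten ss) -> x \in nth [::] ss i -> x \in nth [::] ss j -> i = j.
Proof.
have mem_nth_flatten (tt : seq (seq T)) k : x \in nth [::] tt k -> x \in flatten tt.
  move=> xk; apply/flattenP; exists (nth [::] tt k) => //; apply: mem_nth.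
  by apply: contraTT xk; rewrite -leqNgt => /(nth_default _) ->.
elim: ss i j => [|s ss IH] [|i] [|j] //=; rewrite ?nth_nil //.
- rewrite cat_uniq => /and3P[_ /hasPn h _] xs /mem_nth_flatten/h.
  by rewrite /= xs.
- rewrite cat_uniq => /and3P[_ /hasPn h _] /mem_nth_flatten/h /negP hx xs.
  by case: hx.
- by rewrite cat_uniq => /and3P[_ _ u] xi xj; rewrite (IH i j).
Qed.

Lemma Forall2_nth (S T : Type) (P : S -> T -> Prop) (x0 : S) (y0 : T) s t :
  size s = size t ->
  (forall i, (i < size s)%N -> P (nth x0 s i) (nth y0 t i)) ->
  List.Forall2 P s t.
Proof.
elim: s t => [|x s IH] [|y t] //= [st] H; constructor; first exact: (H 0%N).
by apply: IH => // i; exact: (H i.+1).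
Qed.

Lemma invmxM (K : comUnitRingType) m (A B : 'M[K]_m) :
  A \in unitmx -> B \in unitmx -> invmx (A *m B) = invmx B *m invmx A.
Proof.
move=> uA uB; have uAB : A *m B \in unitmx by rewrite unitmx_mul uA.
by apply: (can_inj (mulKmx uAB)); rewrite mulmxV // mulmxA mulmxK // mulmxV.
Qed.

Section CosetAction.
Local Notation mat := 'M[int]_2.

(** [K g] is the label of the coset [g * G]; the generators act on labels by
    [st] and [tt]. *)
Variables (G : set mat) (n : nat) (st tt : nat -> nat) (K : mat -> nat).
Hypothesis K_lt : forall g, SL2Z g -> (K g < n)%N.
Hypothesis K_shear : forall g, SL2Z g -> K (shearZ *m g) = tt (K g).
Hypothesis K_rot : forall g, SL2Z g -> K (rotZ *m g) = st (K g).
Hypothesis K_coset : forall g g', SL2Z g -> SL2Z g' ->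
  (K g = K g' <-> G (invmx g' *m g)).
Hypothesis K_surj : forall k, (k < n)%N -> exists2 g, SL2Z g & K g = k.
Hypothesis G_SL2Z : G `<=` @SL2Z.
Hypothesis stst : forall k, (k < n)%N -> st (st k) = k.

Lemma coset_label g : SL2Z g ->
  [set g *m h | h in G] = [set g' | SL2Z g' /\ K g' = K g].
Proof.
move=> sg; have ug := SL2Z_unit sg; apply/seteqP; split=> [_ [h Gh <-]|g' [sg' KE]].
  have sgh := SL2ZM sg (G_SL2Z Gh).
  by split => //; apply/K_coset => //; rewrite mulKmx.
exists (invmx g *m g'); last by rewrite mulKVmx.
exact/K_coset.
Qed.

Lemma coset_index : has_index (@SL2Z) G n.
Proof.
split => //; rewrite card_eq_sym; apply/card_set_bijP.
exists (fun k => [set g | SL2Z g /\ K g = k]); split.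
- move=> k /K_surj[g sg <-]; exists g => //; exact: coset_label.
- move=> k l; rewrite !inE => /K_surj[g sg gk] _ /seteqP[/(_ g) + _].
  by rewrite /= => /(_ (conj sg gk)) [_ <-].
- move=> _ [g sg <-]; exists (K g); first exact: K_lt.
  by rewrite coset_label.
Qed.

Lemma G1 : G 1%:M.
Proof.
have := (K_coset SL2Z1 SL2Z1).1 erefl; rewrite mulVmx //.
exact: SL2Z_unit SL2Z1.
Qed.

Lemma K_mulr g h : SL2Z g -> G h -> K (g *m h) = K g.
Proof.
move=> sg Gh; apply/K_coset => //; first exact: SL2ZM (G_SL2Z Gh).
by rewrite mulKmx // SL2Z_unit.
Qed.

(** As the rotation acts on the labels by an involution, [-1] acts trivially; this
    is why the signs in [stabilizer_infty] are harmless. *)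
Lemma K_opp g : SL2Z g -> K (- g) = K g.
Proof.
move=> sg; have -> : - g = rotZ *m (rotZ *m g).
  by rewrite mulmxA mulmx2 [g in LHS]mx2_eta [g in RHS]mx2_eta mulmx2;
     apply: mx2P; rewrite !mxE /=; ring.
by rewrite K_rot ?K_rot ?stst ?K_lt //; exact: SL2ZM SL2Z_rot _.
Qed.

Lemma K_shear_iter (m : nat) g : SL2Z g -> K (mx2 1 m%:Z 0 1 *m g) = iter m tt (K g).
Proof.
move=> sg; elim: m => [|m IH]; first by rewrite mx2_1 mul1mx.
rewrite iterS -IH -K_shear; last exact: SL2ZM (SL2Z_shear _) _.
by rewrite mulmxA mulmx2; congr (K (mx2 _ _ _ _ *m g)); lia.
Qed.

Lemma tt_lt k : (k < n)%N -> (tt k < n)%N.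
Proof.
move=> /K_surj[g sg <-]; rewrite -K_shear //; apply: K_lt.
exact: SL2ZM (SL2Z_shear 1) _.
Qed.

Lemma iter_tt_lt m k : (k < n)%N -> (iter m tt k < n)%N.
Proof. by move=> kn; elim: m => //= m; apply: tt_lt. Qed.

Lemma tt_inj k l : (k < n)%N -> (l < n)%N -> tt k = tt l -> k = l.
Proof.
move=> /K_surj[g sg <-] /K_surj[h sh <-].
rewrite -!K_shear // => /K_coset H; apply/K_coset => //.
have sT : SL2Z shearZ := SL2Z_shear 1.
have := H (SL2ZM sT sg) (SL2ZM sT sh).
have -> : invmx (shearZ *m h) = invmx h *m invmx shearZ.
  by rewrite invmxM ?SL2Z_unit.
by rewrite -mulmxA mulKmx // SL2Z_unit.
Qed.

Lemma iter_tt_inj m k l : (k < n)%N -> (l < n)%N ->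
  iter m tt k = iter m tt l -> k = l.
Proof.
move=> kn ln; elim: m => //= m IH E; apply: IH; apply: tt_inj E; exact: iter_tt_lt.
Qed.

(** [g^-1 h g'] fixes infinity, so up to sign it is a power [T^m] of the shear, and
    [g^-1 h], which has the label of [g^-1], is [T^m g'^-1] up to sign. *)
Lemma same_cusp_label g g' h : SL2Z g -> SL2Z g' -> G h ->
  moebius h (moebius g' inftyQ) = moebius g inftyQ ->
  exists m, iter m tt (K (invmx g')) = K (invmx g) \/
            iter m tt (K (invmx g)) = K (invmx g').
Proof.
move=> sg sg' Gh hE; have sh := G_SL2Z Gh.
have sV := SL2ZV sg; have sV' := SL2ZV sg'.
have stab : moebius (invmx g *m h *m g') inftyQ = inftyQ.
  rewrite moebiusM //; last exact: SL2ZM.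
  have -> : moebius g' inftyQ = moebius (invmx h) (moebius g inftyQ).
    by rewrite -hE -moebiusM // -moebiusM ?mulKmx //; [exact: SL2Z_unit|exact: SL2ZV|exact: SL2ZM].
  rewrite -(moebiusM (SL2ZV sh) sg) -(moebiusM (SL2ZM sV sh) (SL2ZM (SL2ZV sh) sg)).
  rewrite -mulmxA mulKVmx ?SL2Z_unit // mulVmx ?SL2Z_unit //.
  by rewrite moebius_infty !mxE.
have sS : SL2Z (invmx g *m h *m g') by do !apply: SL2ZM.
have [m mE] := stabilizer_infty sS stab.
have E : K (invmx g) = K (mx2 1 m 0 1 *m invmx g').
  rewrite -(K_mulr sV Gh) -[invmx g *m h](mulmxK (SL2Z_unit sg')).
  case: mE => ->; first by [].
  by rewrite mulNmx K_opp //; exact: SL2ZM (SL2Z_shear _) _.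
case: m E {mE} => m E; first by exists m; left; rewrite E K_shear_iter.
exists m.+1; right.
have -> : K (invmx g') = K (mx2 1 m.+1%:Z 0 1 *m (mx2 1 (Negz m) 0 1 *m invmx g')).
  rewrite mulmxA mulmx2 NegzE (_ : mx2 _ _ _ _ = 1%:M) ?mul1mx // -mx2_1.
  by congr mx2; ring.
by rewrite K_shear_iter -?E //; exact: SL2ZM (SL2Z_shear _) _.
Qed.

(** If [T^m g^-1] and [g'^-1] have the same label, then [g T^-m g'^-1] is in [G],
    and [T^-m] fixes infinity. *)
Lemma label_same_cusp g g' m : SL2Z g -> SL2Z g' ->
  iter m tt (K (invmx g)) = K (invmx g') ->
  exists2 h, G h & moebius h (moebius g' inftyQ) = moebius g inftyQ.
Proof.
move=> sg sg'; have sV := SL2ZV sg; have sV' := SL2ZV sg'.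
rewrite -K_shear_iter // => E; pose t := mx2 1 m%:Z 0 1.
have st' : SL2Z t := SL2Z_shear _.
exists (g *m invmx t *m invmx g').
  have := (K_coset sV' (SL2ZM st' sV)).1 (esym E); congr G; congr (_ *m _).
  by rewrite invmxM ?invmxK // ?unitmx_inv SL2Z_unit.
rewrite -moebiusM //; last by do !apply: SL2ZM => //; exact: SL2ZV.
rewrite mulmxKV ?SL2Z_unit // moebiusM //; last exact: SL2ZV.
congr moebius; rewrite /t invmx2 ?mulr0 ?subr0 // moebius_infty !mxE /= oppr0 //.
Qed.

Section CuspData.
Variables (gs : seq mat) (ws : seq nat).
Let g i := nth 1%:M gs i.
Let k i := K (invmx (g i)).
Let w i := nth 0%N ws i.
Let orbits := [seq traject tt (k i) (w i) | i <- iota 0 (size gs)].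
Hypothesis gs_SL2Z : forall i, (i < size gs)%N -> SL2Z (g i).
Hypothesis size_ws : size ws = size gs.
Hypothesis orbits_partition : perm_eq (flatten orbits) (iota 0 n).
Hypothesis w_gt0 : forall i, (i < size gs)%N -> (0 < w i)%N.
Hypothesis w_period : forall i, (i < size gs)%N -> iter (w i) tt (k i) = k i.

Lemma nth_orbits i : (i < size gs)%N ->
  nth [::] orbits i = traject tt (k i) (w i).
Proof. by move=> hi; rewrite (nth_map 0%N) ?size_iota // nth_iota. Qed.

Lemma k_lt i : (i < size gs)%N -> (k i < n)%N.
Proof. by move=> hi; apply: K_lt; apply: SL2ZV; apply: gs_SL2Z. Qed.

Lemma orbit_exists a : (a < n)%N -> exists2 i, (i < size gs)%N &
  a \in traject tt (k i) (w i).
Proof.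
move=> an; have : a \in flatten orbits by rewrite (perm_mem orbits_partition) mem_iota.
case/flattenP => s /mapP[i]; rewrite mem_iota add0n => hi -> ai.
by exists i.
Qed.

Lemma orbit_unique a i j : (i < size gs)%N -> (j < size gs)%N ->
  a \in traject tt (k i) (w i) -> a \in traject tt (k j) (w j) -> i = j.
Proof.
move=> hi hj ai aj; apply: (@flatten_uniq_index _ orbits a); rewrite ?nth_orbits //.
by rewrite (perm_uniq orbits_partition) iota_uniq.
Qed.

(** The trajectories close up, so they are orbits. *)
Lemma orbit_closed a m i : (i < size gs)%N ->
  a \in traject tt (k i) (w i) -> iter m tt a \in traject tt (k i) (w i).
Proof.
move=> hi ai; elim: m => //= m; set b := iter m tt a => /trajectP[p pw ->].
apply/trajectP; have [pw1|pw1] := ltnP p.+1 (w i); first by exists p.+1.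
exists 0%N; first exact: w_gt0.
by rewrite -iterS (_ : p.+1 = w i) ?w_period //; apply/eqP; rewrite eqn_leq pw.
Qed.

Lemma orbit_iter a b m i j : (i < size gs)%N -> (j < size gs)%N -> (a < n)%N ->
  iter m tt a = b ->
  a \in traject tt (k i) (w i) -> b \in traject tt (k j) (w j) -> i = j.
Proof. by move=> hi hj an <- ai; apply: orbit_unique hi hj (orbit_closed _ hi ai). Qed.

Lemma k_in_orbit i : (i < size gs)%N -> k i \in traject tt (k i) (w i).
Proof. by move=> hi; apply/trajectP; exists 0%N; rewrite // w_gt0. Qed.

Lemma orbit_back a i : (i < size gs)%N -> a \in traject tt (k i) (w i) ->
  exists m, iter m tt a = k i.
Proof.
move=> hi /trajectP[m mw ->]; exists (w i - m)%N.
by rewrite -iterD subnK ?w_period // ltnW.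
Qed.

Lemma same_cusp_index h h' x i j : SL2Z h -> SL2Z h' -> G x ->
  moebius x (moebius h' inftyQ) = moebius h inftyQ ->
  (i < size gs)%N -> (j < size gs)%N ->
  K (invmx h) \in traject tt (k i) (w i) ->
  K (invmx h') \in traject tt (k j) (w j) -> i = j.
Proof.
move=> sh sh' Gx xE hi hj ai aj.
have [m [E|E]] := same_cusp_label sh sh' Gx xE.
  by apply/esym; apply: orbit_iter hj hi _ E aj ai; apply: K_lt; exact: SL2ZV.
by apply: orbit_iter hi hj _ E ai aj; apply: K_lt; exact: SL2ZV.
Qed.

Lemma moebius_id (h : mat) : SL2Z h ->
  moebius 1%:M (moebius h inftyQ) = moebius h inftyQ.
Proof. by move=> sh; rewrite -moebiusM ?mul1mx //; exact: SL2Z1. Qed.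

Lemma cusps_distinct i j : (i < size gs)%N -> (j < size gs)%N ->
  moebius (g i) inftyQ = moebius (g j) inftyQ -> i = j.
Proof.
move=> hi hj E; apply: (@same_cusp_index (g i) (g j) 1%:M) => //.
- exact: gs_SL2Z.
- exact: gs_SL2Z.
- exact: G1.
- by rewrite moebius_id ?E //; exact: gs_SL2Z.
- exact: k_in_orbit.
- exact: k_in_orbit.
Qed.

Lemma cusp_representativesP :
  cusp_representatives G [seq moebius h inftyQ | h <- gs].
Proof.
have nthE i : (i < size gs)%N ->
    nth inftyQ [seq moebius h inftyQ | h <- gs] i = moebius (g i) inftyQ.
  by move=> hi; rewrite (nth_map 1%:M).
split.
  apply/(uniqP inftyQ) => i j; rewrite !inE size_map => hi hj.
  by rewrite !nthE //; exact: cusps_distinct.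
move=> C [x _ <-]; have [h sh <-] := SL2Z_transitive x.
have sV := SL2ZV sh; have [i hi ai] := orbit_exists (K_lt sV).
exists (moebius (g i) inftyQ); split.
  split; first by apply: map_f; exact: mem_nth.
  have [m E] := orbit_back hi ai.
  have [y Gy yE] := label_same_cusp sh (gs_SL2Z hi) E.
  exists (invmx y).
    have sy := G_SL2Z Gy.
    have := (K_coset SL2Z1 sy).1; rewrite mulmx1; apply.
    by apply/esym/K_coset => //; [exact: SL2Z1|rewrite invmx1 mul1mx].
  by rewrite -yE moebiusK //; [exact: G_SL2Z|exact: gs_SL2Z].
move=> c [/(nthP inftyQ)[j]]; rewrite size_map => hj <- [y Gy].
rewrite nthE // => yE; congr (moebius (g _) _).
apply/esym; apply: (@same_cusp_index (g j) h y) => //.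
- exact: gs_SL2Z.
- exact: k_in_orbit.
Qed.

Lemma conjugate_transvection h p : SL2Z h ->
  conjugate_group G h (transvection p) <-> iter p tt (K (invmx h)) = K (invmx h).
Proof.
move=> sh; have sV := SL2ZV sh; have uh := SL2Z_unit sh.
rewrite transvectionE -K_shear_iter // K_coset //; last exact: SL2ZM (SL2Z_shear _) _.
rewrite invmxK; set t := mx2 _ _ _ _; split=> [[y Gy <-]|Gt].
  by rewrite mulmxK // mulKVmx.
by exists (h *m (t *m invmx h)) => //; rewrite mulKmx // mulmxKV.
Qed.

(** [T^p] is in [g^-1 G g] if and only if [p] is a period of the label of [g^-1]
    under the shear ([conjugate_transvection]), and all the labels of an orbit
    have the same least period. *)
Lemma cusp_widthP i : (i < size gs)%N ->
  cusp_width G (moebius (g i) inftyQ) (w i).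
Proof.
move=> hi h sh hE; have sV := SL2ZV sh.
have [j hj aj] := orbit_exists (K_lt sV).
have ij : i = j.
  apply: (@same_cusp_index (g i) h 1%:M) => //; [exact: gs_SL2Z|exact: G1| |exact: k_in_orbit].
  by rewrite moebius_id.
rewrite -{j hj}ij in aj; case/trajectP: aj => m mw aE.
split; first exact: w_gt0.
  by apply/conjugate_transvection => //; rewrite aE -iterD addnC iterD w_period.
move=> p p0 /conjugate_transvection => /(_ sh); rewrite aE -iterD addnC iterD.
move=> /iter_tt_inj E; have {}E := E (iter_tt_lt _ (k_lt hi)) (k_lt hi).
rewrite leqNgt; apply/negP => pw.
have : uniq (traject tt (k i) (w i)).
  have : uniq (flatten orbits) by rewrite (perm_uniq orbits_partition) iota_uniq.
  rewrite -(nth_orbits hi); have : (i < size orbits)%N by rewrite size_map size_iota.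
  elim: orbits (i) => // s ss IH [|l] /=; first by rewrite cat_uniq => _ /and3P[].
  by rewrite ltnS cat_uniq => hl /and3P[_ _ u]; apply: IH.
move=> /(nth_uniq (k i)); rewrite size_traject => /(_ 0%N p (w_gt0 hi) pw).
by rewrite (nth_traject _ (w_gt0 hi)) (nth_traject _ pw) /= E eqxx => /esym/eqP p0'; rewrite -p0' in p0.
Qed.

Lemma cusp_widthsP :
  List.Forall2 (cusp_width G) [seq moebius h inftyQ | h <- gs] ws.
Proof.
apply: (@Forall2_nth _ _ _ inftyQ 0%N); rewrite size_map // => i hi.
by rewrite (nth_map 1%:M) //; exact: cusp_widthP.
Qed.

End CuspData.
End CosetAction.

(** * The Veech group as the stabilizer of a conjugacy class *)

Section Moves.
Variable N : nat.
Local Notation pairs := ({perm 'I_N} * {perm 'I_N})%type.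

Definition rot_pair (p : pairs) : pairs := (p.2^-1%g, p.1).
Definition shear_pair (p : pairs) : pairs := (p.1, (p.1^-1 * p.2)%g).

(** Words in the generators of SL(2,Z), [true] for the shear and [false] for
    the rotation; the last letter acts first. *)
Definition act_pair (w : seq bool) (p : pairs) : pairs :=
  foldr (fun b q => if b then shear_pair q else rot_pair q) p w.

Definition intertwines (s : 'I_N -> 'I_N) (p q : pairs) : Prop :=
  (forall i, s (p.1 i) = q.1 (s i)) /\ (forall i, s (p.2 i) = q.2 (s i)).

Definition conj_pair (p q : pairs) : Prop :=
  exists s : {perm 'I_N}, intertwines s p q.

End Moves.

Definition mat_word (w : seq bool) : 'M[int]_2 :=
  foldr (fun b g => (if b then shearZ else rotZ) *m g) 1%:M w.

Definition label_word (st tt : nat -> nat) (w : seq bool) : nat :=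
  foldr (fun b k => if b then tt k else st k) 0%N w.

Lemma SL2Z_mat_word w : SL2Z (mat_word w).
Proof.
elim: w => [|b w IH]; first exact: SL2Z1.
by apply: SL2ZM => //; case: b; [exact: SL2Z_shear|exact: SL2Z_rot].
Qed.

Section Intmx.
Variable R : realType.

Lemma intmxM (A B : 'M[int]_2) : intmx R (A *m B) = intmx R A *m intmx R B.
Proof. exact: map_mxM. Qed.

Lemma intmx1 : intmx R 1%:M = 1%:M.
Proof. exact: map_mx1. Qed.

Lemma intmx_mx2 (a b c d : int) :
  intmx R (mx2 a b c d) = mx2 a%:~R b%:~R c%:~R d%:~R.
Proof. by apply: mx2P; rewrite !mxE. Qed.

Lemma intmx_unit (A : 'M[int]_2) : SL2Z A -> intmx R A \in unitmx.
Proof. by rewrite /SL2Z /= => dA; rewrite unitmxE det_map_mx dA unitr1. Qed.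

End Intmx.

Section VeechGroup.
Variables (R : realType) (N : nat) (p0 : {perm 'I_N} * {perm 'I_N}) (i0 : 'I_N).
Variables (words : seq (seq bool)) (st tt : nat -> nat).
Local Notation n := (size words).
Local Notation X p := (square_tiled R p.1 p.2).
Let rep k := act_pair (nth [::] words k) p0.

Hypothesis n_gt0 : (0 < n)%N.
Hypothesis words0 : nth [::] words 0 = [::].
Hypothesis st_lt : forall k, (k < n)%N -> (st k < n)%N.
Hypothesis tt_lt : forall k, (k < n)%N -> (tt k < n)%N.
Hypothesis st_surj : forall k, (k < n)%N -> exists2 l, (l < n)%N & st l = k.
Hypothesis tt_surj : forall k, (k < n)%N -> exists2 l, (l < n)%N & tt l = k.
Hypothesis stst : forall k, (k < n)%N -> st (st k) = k.
Hypothesis rep_rot : forall k, (k < n)%N -> conj_pair (rot_pair (rep k)) (rep (st k)).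
Hypothesis rep_shear : forall k, (k < n)%N ->
  conj_pair (shear_pair (rep k)) (rep (tt k)).
Hypothesis label_words : forall k, (k < n)%N ->
  label_word st tt (nth [::] words k) = k.
Hypothesis rep_distinct : forall k, (0 < k < n)%N ->
  ~ exists s : 'I_N -> 'I_N, intertwines s p0 (rep k).
Hypothesis row_singular : singular p0.1 p0.2 i0 /\ singular p0.1 p0.2 (p0.1 i0).
Hypothesis column_singular : exists i, singular p0.1 p0.2 i /\ singular p0.1 p0.2 (p0.2 i).
Hypothesis transitive_squares : forall P : 'I_N -> Prop, P i0 ->
  (forall i, P i -> P (p0.1 i)) -> (forall i, P i -> P (p0.2 i)) -> forall i, P i.

Lemma rep_rot_iso k : (k < n)%N ->
  tsurface_iso (sl_act (intmx R rotZ) (X (rep k))) (X (rep (st k))).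
Proof.
move=> kn; have [s [hs vs]] := rep_rot kn.
have := tsurface_iso_comp (rotate_iso R (rep k).1 (rep k).2) (relabel_iso R hs vs).
by rewrite mul1mx intmx_mx2.
Qed.

Lemma rep_shear_iso k : (k < n)%N ->
  tsurface_iso (sl_act (intmx R shearZ) (X (rep k))) (X (rep (tt k))).
Proof.
move=> kn; have [s [hs vs]] := rep_shear kn.
have := tsurface_iso_comp (shear_iso R (rep k).1 (rep k).2) (relabel_iso R hs vs).
by rewrite mul1mx intmx_mx2.
Qed.

Let rel g k := tsurface_iso (sl_act (intmx R g) (X p0)) (X (rep k)).

Lemma rel1 : rel 1%:M 0.
Proof.
by rewrite /rel /rep words0 intmx1; apply: (@relabel_iso _ _ _ _ _ _ 1%g) => i; rewrite !perm1.
Qed.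

Lemma rel_total g : SL2Z g -> exists2 k, (k < n)%N & rel g k.
Proof.
move: g; apply: SL2Z_ind; first by exists 0%N => //; exact: rel1.
- move=> g _ [k kn rk]; exists (tt k); first exact: tt_lt.
  by rewrite /rel intmxM; apply: tsurface_iso_comp rk (rep_shear_iso kn).
- move=> g _ [k kn rk]; exists (st k); first exact: st_lt.
  by rewrite /rel intmxM; apply: tsurface_iso_comp rk (rep_rot_iso kn).
Qed.

Lemma label_word_lt w : (label_word st tt w < n)%N.
Proof. by elim: w => //= -[] w IH; [exact: tt_lt|exact: st_lt]. Qed.

Lemma rel_word w : rel (mat_word w) (label_word st tt w).
Proof.
elim: w => [|[] w IH] /=; first exact: rel1.
- by rewrite /rel intmxM; apply: tsurface_iso_comp IH (rep_shear_iso (label_word_lt w)).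
- by rewrite /rel intmxM; apply: tsurface_iso_comp IH (rep_rot_iso (label_word_lt w)).
Qed.

(** Only the first representative has to be told apart from the others: the
    generators of SL(2,Z) permute the representatives. *)
Lemma rep_iso_eq k l : (k < n)%N -> (l < n)%N ->
  tsurface_iso (sl_act 1%:M (X (rep k))) (X (rep l)) -> k = l.
Proof.
move=> kn; rewrite -(label_words kn); move: (nth _ _ _) l => w {k kn}.
elim: w => [|b w IH] l ln /=.
  rewrite /rep words0 /= => iso0; apply/eqP; rewrite eq_sym; apply: contraT.
  rewrite -lt0n => l0; case: (@rep_distinct l); first by rewrite l0.
  have [si0 _] := row_singular.
  have [s sP] := translation_iso_conj si0 transitive_squares iso0.
  by exists s.
have kn := label_word_lt w; set k := label_word st tt w in IH kn *.
have step (A : 'M[int]_2) (f : nat -> nat) : SL2Z A ->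
    (forall k, (k < n)%N -> tsurface_iso (sl_act (intmx R A) (X (rep k))) (X (rep (f k)))) ->
    (forall k, (k < n)%N -> exists2 l, (l < n)%N & f l = k) ->
    tsurface_iso (sl_act 1%:M (X (rep (f k)))) (X (rep l)) -> f k = l.
  move=> sA fiso fsurj iso1; have [l' ln' lE] := fsurj l ln.
  rewrite -lE in iso1 *; congr f; apply: IH => //.
  have uA := intmx_unit R sA.
  have := tsurface_iso_comp (tsurface_iso_comp (fiso k kn) iso1)
                            (tsurface_iso_inv uA (fiso l' ln')).
  by rewrite mul1mx mulVmx.
case: b; first exact: step (SL2Z_shear 1) rep_shear_iso tt_surj.
exact: step SL2Z_rot rep_rot_iso st_surj.
Qed.

Lemma rel_unique g k l : SL2Z g -> (k < n)%N -> (l < n)%N ->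
  rel g k -> rel g l -> k = l.
Proof.
move=> sg kn ln rk rl; apply: rep_iso_eq => //; have ug := intmx_unit R sg.
have := tsurface_iso_comp (tsurface_iso_inv ug rk) rl.
by rewrite mulmxV.
Qed.

Lemma veech_groupZ_SL2Z : veech_groupZ (X p0) `<=` @SL2Z.
Proof.
move=> A [+ _]; rewrite /SL2R /SL2Z /= /intmx det_map_mx => h.
exact: (@intr_inj R _ 1 h).
Qed.

Lemma veech_group_integral : veech_group (X p0) `<=` [set intmx R A | A in @SL2Z].
Proof.
move=> A [detA iso]; have [si sr] := row_singular; have [j [sj st']] := column_singular.
have AZ := iso_integral si sr sj st' iso.
pose B : 'M[int]_2 := \matrix_(k, l) Num.floor (A k l).
have BE : intmx R B = A.
  by apply/matrixP => k l; rewrite !mxE; have /intrP[m ->] := AZ k l; rewrite intrKfloor.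
exists B => //; apply: veech_groupZ_SL2Z; split; rewrite BE //.
Qed.

Section Label.
Variable K : 'M[int]_2 -> nat.
Hypothesis KP : forall g, SL2Z g -> (K g < n)%N /\ rel g (K g).

Lemma K_lt g : SL2Z g -> (K g < n)%N. Proof. by move=> /KP[]. Qed.

Lemma K_eq g k : SL2Z g -> (k < n)%N -> rel g k -> K g = k.
Proof. by move=> sg kn; have [Kn rK] := KP sg; apply: rel_unique. Qed.

Lemma K_shear g : SL2Z g -> K (shearZ *m g) = tt (K g).
Proof.
move=> sg; have [Kn rK] := KP sg; apply: K_eq.
- exact: SL2ZM (SL2Z_shear 1) sg.
- exact: tt_lt.
- by rewrite /rel intmxM; apply: tsurface_iso_comp rK (rep_shear_iso Kn).
Qed.

Lemma K_rot g : SL2Z g -> K (rotZ *m g) = st (K g).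
Proof.
move=> sg; have [Kn rK] := KP sg; apply: K_eq.
- exact: SL2ZM SL2Z_rot sg.
- exact: st_lt.
- by rewrite /rel intmxM; apply: tsurface_iso_comp rK (rep_rot_iso Kn).
Qed.

Lemma K_word w : K (mat_word w) = label_word st tt w.
Proof.
by apply: K_eq; [exact: SL2Z_mat_word|exact: label_word_lt|exact: rel_word].
Qed.

Lemma K_surj k : (k < n)%N -> exists2 g, SL2Z g & K g = k.
Proof.
move=> kn; exists (mat_word (nth [::] words k)); first exact: SL2Z_mat_word.
by rewrite K_word label_words.
Qed.

Lemma K_coset g g' : SL2Z g -> SL2Z g' ->
  (K g = K g' <-> veech_groupZ (X p0) (invmx g' *m g)).
Proof.
move=> sg sg'; have [Kn rK] := KP sg; have [Kn' rK'] := KP sg'.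
have rep0 : rep 0 = p0 by rewrite /rep words0.
have sA : SL2Z (invmx g' *m g) by apply: SL2ZM => //; exact: SL2ZV.
have gE : g = g' *m (invmx g' *m g) by rewrite mulKVmx // SL2Z_unit.
split=> [KE|[_ isoA]].
  split; first by rewrite /SL2R /= /intmx det_map_mx sA.
  have ug := intmx_unit R sg'.
  rewrite KE in rK; have := tsurface_iso_comp rK (tsurface_iso_inv ug rK').
  by rewrite {1}gE intmxM mulKmx.
apply: K_eq => //; rewrite gE /rel intmxM.
exact: tsurface_iso_comp isoA rK'.
Qed.

End Label.

Lemma veech_data_words (cws : seq (seq bool)) (ws : seq nat) :
  size ws = size cws ->
  (forall i, (i < size cws)%N -> (0 < nth 0 ws i)%N /\
     iter (nth 0%N ws i) tt (label_word st tt (nth [::] cws i)) =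
     label_word st tt (nth [::] cws i)) ->
  perm_eq (flatten [seq traject tt (label_word st tt (nth [::] cws i)) (nth 0%N ws i)
                   | i <- iota 0 (size cws)]) (iota 0 n) ->
  veech_data (X p0) n [seq moebius (invmx (mat_word u)) inftyQ | u <- cws] ws.
Proof.
move=> sz wP orbP.
have /choice[K KP] : forall g, exists k, SL2Z g -> (k < n)%N /\ rel g k.
  move=> g; have [sg|nsg] := pselect (SL2Z g); last by exists 0%N.
  by have [k kn rk] := rel_total sg; exists k.
have Klt := K_lt KP; have Ksh := K_shear KP; have Krot := K_rot KP.
have Kco := K_coset KP; have Ksu := K_surj KP.
pose gs := [seq invmx (mat_word u) | u <- cws].
have szg : size gs = size cws by rewrite size_map.
have gE i : (i < size gs)%N -> nth 1%:M gs i = invmx (mat_word (nth [::] cws i)).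
  by rewrite szg => hi; rewrite (nth_map [::]).
have KgE i : (i < size gs)%N ->
    K (invmx (nth 1%:M gs i)) = label_word st tt (nth [::] cws i).
  by move=> hi; rewrite gE // invmxK K_word.
have gS i : (i < size gs)%N -> SL2Z (nth 1%:M gs i).
  by move=> hi; rewrite gE //; apply: SL2ZV; exact: SL2Z_mat_word.
have orbP' : perm_eq (flatten [seq traject tt (K (invmx (nth 1%:M gs i))) (nth 0%N ws i)
    | i <- iota 0 (size gs)]) (iota 0 n).
  rewrite szg (_ : [seq _ | i <- _] = [seq traject tt (label_word st tt (nth [::] cws i))
    (nth 0%N ws i) | i <- iota 0 (size cws)]) //.
  by apply/eq_in_map => i; rewrite mem_iota add0n -szg => hi; rewrite KgE.
have w0 i : (i < size gs)%N -> (0 < nth 0 ws i)%N.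
  by rewrite szg => /wP[].
have wper i : (i < size gs)%N -> iter (nth 0%N ws i) tt (K (invmx (nth 1%:M gs i))) =
    K (invmx (nth 1%:M gs i)).
  by move=> hi; rewrite KgE //; rewrite szg in hi; have [] := wP i hi.
have szw : size ws = size gs by rewrite szg.
have csE : [seq moebius (invmx (mat_word u)) inftyQ | u <- cws] =
           [seq moebius h inftyQ | h <- gs] by rewrite -map_comp.
rewrite csE; split.
- exact: veech_group_integral.
- exact: coset_index Klt Kco Ksu veech_groupZ_SL2Z.
- exact: (@cusp_representativesP _ _ _ _ _ Klt Ksh Krot Kco veech_groupZ_SL2Z stst
    gs ws gS orbP' w0 wper).
- exact: (@cusp_widthsP _ _ _ _ _ Klt Ksh Krot Kco Ksu veech_groupZ_SL2Z stst
    gs ws gS szw orbP' w0 wper).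
Qed.

End VeechGroup.

(** * Tables of permutations *)

Section Tables.
Variable N : nat.
Implicit Types (s t : {perm 'I_N}) (l m : seq nat).

Definition table s : seq nat := [seq nat_of_ord (s i) | i <- enum 'I_N].
Definition table_inv l : seq nat := [seq index k l | k <- iota 0 N].
Definition table_mul l m : seq nat := [seq nth 0%N m k | k <- l].

Lemma nth_table s (i : 'I_N) : nth 0%N (table s) i = s i.
Proof. by rewrite (nth_map i) ?size_enum_ord // nth_ord_enum. Qed.

Lemma table_eq l (f : 'I_N -> nat) : size l = N ->
  (forall i : 'I_N, nth 0%N l i = f i) -> l = [seq f i | i <- enum 'I_N].
Proof.
move=> szl lf; have szf : size [seq f i | i <- enum 'I_N] = N.
  by rewrite size_map size_enum_ord.
apply: (@eq_from_nth _ 0%N) => [|i]; first by rewrite szl szf.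
rewrite szl => iN; rewrite -[i]/(nat_of_ord (Ordinal iN)) lf.
by rewrite (nth_map (Ordinal iN)) ?size_enum_ord // nth_ord_enum.
Qed.

Lemma table_invE s : table s^-1%g = table_inv (table s).
Proof.
apply/esym/table_eq; first by rewrite size_map size_iota.
move=> i; rewrite (nth_map 0%N) ?size_iota // nth_iota // add0n.
have {1}-> : nat_of_ord i = nth 0%N (table s) (s^-1%g i) by rewrite nth_table permKV.
have u : uniq (table s) by rewrite map_inj_uniq ?enum_uniq // => a b /val_inj/perm_inj.
by rewrite index_uniq // size_map size_enum_ord.
Qed.

Lemma table_mulE s t : table (s * t)%g = table_mul (table s) (table t).
Proof.
apply/esym/table_eq; first by rewrite 2!size_map size_enum_ord.
move=> i; rewrite (nth_map 0%N); last by rewrite size_map size_enum_ord.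
by rewrite nth_table nth_table permM.
Qed.

(** The inverses are carried along, so that the moves need no search. *)
Record tables := Tables {
  right_of : seq nat; left_of : seq nat; above : seq nat; below : seq nat
}.

Definition pair_table (p : {perm 'I_N} * {perm 'I_N}) : tables :=
  Tables (table p.1) (table p.1^-1%g) (table p.2) (table p.2^-1%g).
Definition rot_table (q : tables) : tables :=
  Tables (below q) (above q) (right_of q) (left_of q).
Definition shear_table (q : tables) : tables :=
  Tables (right_of q) (left_of q) (table_mul (left_of q) (above q))
         (table_mul (below q) (right_of q)).
Definition act_table (w : seq bool) (q : tables) : tables :=
  foldr (fun b q => if b then shear_table q else rot_table q) q w.

Lemma rot_tableE p : pair_table (rot_pair p) = rot_table (pair_table p).
Proof. by rewrite /pair_table /rot_table /= invgK. Qed.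

Lemma shear_tableE p : pair_table (shear_pair p) = shear_table (pair_table p).
Proof. by rewrite /pair_table /shear_table /= invMg invgK !table_mulE. Qed.

Lemma act_tableE w p : pair_table (act_pair w p) = act_table w (pair_table p).
Proof.
by elim: w => //= -[] w IH; rewrite ?shear_tableE ?rot_tableE IH.
Qed.

Definition conj_table (c : seq nat) (q q' : tables) : bool :=
  [&& size c == N, uniq c, all (fun k => k < N)%N c,
      all (fun k => nth 0 c (nth 0 (right_of q) k) == nth 0 (right_of q') (nth 0 c k)) (iota 0 N) &
      all (fun k => nth 0 c (nth 0 (above q) k) == nth 0 (above q') (nth 0 c k)) (iota 0 N)]%N.

Lemma conj_tableP c p p' : conj_table c (pair_table p) (pair_table p') ->
  conj_pair p p'.
Proof.
case/and5P=> /eqP szc uc cN hc vc.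
have cP (i : 'I_N) : (nth 0%N c i < N)%N.
  by apply: (allP cN); apply: mem_nth; rewrite szc.
pose f i := Ordinal (cP i).
have f_inj : injective f.
  by move=> i j /(congr1 val) /= /eqP; rewrite nth_uniq ?szc // => /eqP/val_inj.
have inN (i : 'I_N) : val i \in iota 0 N by rewrite mem_iota add0n ltn_ord.
exists (perm f_inj); split=> i; rewrite !permE; apply: val_inj => /=.
  by have /eqP := allP hc _ (inN i); rewrite /= nth_table => ->;
    rewrite -[nth 0%N c i]/(val (f i)) nth_table.
by have /eqP := allP vc _ (inN i); rewrite /= nth_table => ->;
    rewrite -[nth 0%N c i]/(val (f i)) nth_table.
Qed.

(** A relabelling of transitive tables is determined by the image of square
    [0]; [explore] computes it by searching the squares from there, the value
    [N] marking the squares not yet reached. *)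
Fixpoint explore (fuel : nat) (q q' : tables) (stack c : seq nat) : seq nat :=
  if fuel is fuel'.+1 then
    if stack is i :: stack' then
      let visit (m m' : seq nat) (sc : seq nat * seq nat) :=
        let a := nth 0%N m i in
        if nth N sc.2 a == N
        then (a :: sc.1, set_nth N sc.2 a (nth 0%N m' (nth 0%N c i))) else sc in
      let sc := visit (above q) (above q') (visit (right_of q) (right_of q') (stack', c)) in
      explore fuel' q q' sc.1 sc.2
    else c
  else c.

Definition relabelling (q q' : tables) (j : nat) : seq nat :=
  explore N q q' [:: 0%N] (set_nth N (nseq N N) 0 j).

Definition walk (q : tables) (w : seq bool) (i : nat) : nat :=
  foldl (fun i (b : bool) => nth 0%N (if b then right_of q else above q) i) i w.

Lemma walk_intertwines (s : 'I_N -> 'I_N) p p' w (i : 'I_N) : intertwines s p p' ->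
  exists2 a : 'I_N, walk (pair_table p) w i = a & walk (pair_table p') w (s i) = s a.
Proof.
move=> [hs vs]; elim: w i => [|b w IH] i; first by exists i.
case: b; rewrite /= !nth_table.
  by have [a aE] := IH (p.1 i); rewrite hs; exists a.
by have [a aE] := IH (p.2 i); rewrite vs; exists a.
Qed.

Definition loops_separate (loops : seq (seq bool)) (q' : tables) : bool :=
  all (fun j => has (fun w => walk q' w j != j) loops) (iota 0 N).

(** An intertwining map sends the square [0] to a square at which every loop at
    [0] is again a loop. *)
Lemma loops_separateP loops p p' : (0 < N)%N ->
  all (fun w => walk (pair_table p) w 0 == 0)%N loops ->
  loops_separate loops (pair_table p') -> ~ exists s : 'I_N -> 'I_N, intertwines s p p'.
Proof.
move=> N0 /allP l0 /allP sep [s sP]; pose o := Ordinal N0.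
have /hasP[w wl] : has (fun w => walk (pair_table p') w (s o) != s o) loops.
  by apply: sep; rewrite mem_iota add0n ltn_ord.
have [a aE ->] := walk_intertwines w o sP.
have -> : a = o by apply/val_inj => /=; rewrite -aE; exact/eqP/l0.
by rewrite eqxx.
Qed.

Definition singular_table (q : tables) (i : nat) : bool :=
  nth 0%N (above q) (nth 0%N (right_of q) (nth 0%N (below q) (nth 0%N (left_of q) i))) != i.

Lemma singular_tableE p (i : 'I_N) :
  singular_table (pair_table p) i = singular p.1 p.2 i.
Proof. by rewrite /singular_table /= !nth_table. Qed.

(** Sets of squares are lists of booleans indexed by the squares; one step adds the
    squares to the right of and above those already reached. *)
Definition reach (q : tables) (seen : seq bool) : seq bool :=
  [seq nth false seen k || (nth false seen (nth 0%N (left_of q) k)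
         || nth false seen (nth 0%N (below q) k)) | k <- iota 0 N].

Lemma reachP d (p : {perm 'I_N} * {perm 'I_N}) (i0 : 'I_N) (P : 'I_N -> Prop) : P i0 ->
  (forall i, P i -> P (p.1 i)) -> (forall i, P i -> P (p.2 i)) ->
  all id (iter d (reach (pair_table p)) [seq k == val i0 | k <- iota 0 N]) ->
  forall i, P i.
Proof.
move=> P0 P1 P2; set seen := iter d _ _ => /allP H i.
have szd : size seen = N by rewrite /seen; case: d {seen H} => [|d] /=; rewrite size_map size_iota.
have : nth false seen i by apply: H; apply: mem_nth; rewrite szd ltn_ord.
rewrite /seen; move: i {seen szd H}; elim: d => [|d IH] i /=; rewrite (nth_map 0%N) ?size_iota // nth_iota // add0n.
  by move=> /eqP/val_inj ->.
rewrite !nth_table => /orP[/IH//|/orP[/IH/P1|/IH/P2]]; by rewrite permKV.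
Qed.

End Tables.

(** * Certificates *)

(** The data that reduce the determination of a Veech group to a computation
    with tables: words leading from the given pair to the representatives of
    its SL(2,Z)-orbit; for each representative the label of its image under the
    two generators, with the square corresponding to square [0]; loops at square
    [0]; a square with two singular lower corners and a bound on the number of
    steps from it to any other; words for the inverses of matrices that send
    infinity to the cusps. *)
Record certificate := Certificate {
  orbit_words : seq (seq bool);
  rot_moves : seq (nat * nat);
  shear_moves : seq (nat * nat);
  loops : seq (seq bool);
  base_square : nat;
  depth : nat;
  cusp_words : seq (seq bool)
}.

Definition certified (N : nat) (q : tables) (c : certificate)
    (ws : seq nat) : bool :=
  let n := size (orbit_words c) in
  let qs := [seq act_table w q | w <- orbit_words c] in
  let rep := nth q qs in
  let st k := (nth (0, 0)%N (rot_moves c) k).1 in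
  let tt k := (nth (0, 0)%N (shear_moves c) k).1 in
  let label i := label_word st tt (nth [::] (cusp_words c) i) in
  let m := size (cusp_words c) in
  [&& 0 < n, nth [::] (orbit_words c) 0 == [::],
      perm_eq [seq st k | k <- iota 0 n] (iota 0 n),
      perm_eq [seq tt k | k <- iota 0 n] (iota 0 n),
      all (fun k => st (st k) == k) (iota 0 n),
      all (fun k => label_word st tt (nth [::] (orbit_words c) k) == k) (iota 0 n),
      all (fun k => let a := rot_table (rep k) in let b := rep (st k) in
        conj_table N (relabelling N a b (nth (0, 0)%N (rot_moves c) k).2) a b) (iota 0 n),
      all (fun k => let a := shear_table (rep k) in let b := rep (tt k) in
        conj_table N (relabelling N a b (nth (0, 0)%N (shear_moves c) k).2) a b) (iota 0 n),
      all (fun w => walk q w 0 == 0) (loops c),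
      all (fun k => loops_separate N (loops c) (rep k)) (iota 1 n.-1),
      base_square c < N, singular_table q (base_square c),
      singular_table q (nth 0 (right_of q) (base_square c)),
      has (fun i => singular_table q i && singular_table q (nth 0 (above q) i)) (iota 0 N),
      all id (iter (depth c) (reach N q) [seq k == base_square c | k <- iota 0 N]),
      size ws == m,
      all (fun i => (0 < nth 0 ws i) && (iter (nth 0 ws i) tt (label i) == label i)) (iota 0 m) &
      perm_eq (flatten [seq traject tt (label i) (nth 0 ws i) | i <- iota 0 m]) (iota 0 n)]%N.

Lemma perm_iota_bij (f : nat -> nat) n : perm_eq [seq f k | k <- iota 0 n] (iota 0 n) ->
  (forall k, (k < n)%N -> (f k < n)%N) /\
  (forall k, (k < n)%N -> exists2 l, (l < n)%N & f l = k).
Proof.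
move=> /perm_mem p; split=> k kn.
  have : f k \in [seq f k | k <- iota 0 n] by apply: map_f; rewrite mem_iota.
  by rewrite p mem_iota.
have : k \in iota 0 n by rewrite mem_iota.
rewrite -p => /mapP[l]; rewrite mem_iota add0n => ln ->.
by exists l.
Qed.

(** Each clause of [certified] is the computable form of one hypothesis of
    [veech_data_words]. *)
Lemma certifiedP (R : realType) N (sh sv : {perm 'I_N}) q c ws :
  q = pair_table (sh, sv) -> certified N q c ws ->
  veech_data (square_tiled R sh sv) (size (orbit_words c))
    [seq moebius (invmx (mat_word u)) inftyQ | u <- cusp_words c] ws.
Proof.
move=> -> /and5P[n0 /eqP w0 /perm_iota_bij[st_lt st_surj] /perm_iota_bij[tt_lt tt_surj]].
move=> /and5P[/allP stst /allP lab /allP rotc /allP shearc].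
move=> /and5P[loop0 /allP sep iN si]; set p := (sh, sv).
move=> /and5P[sr /hasP[j jN /andP[sj st']] tr /eqP szw /andP[/allP wP orb]].
have inN k : (k < size (orbit_words c))%N -> k \in iota 0 (size (orbit_words c)).
  by rewrite mem_iota.
have repE k : (k < size (orbit_words c))%N ->
    nth (pair_table p) [seq act_table w (pair_table p) | w <- orbit_words c] k =
    pair_table (act_pair (nth [::] (orbit_words c) k) p).
  by move=> kn; rewrite (nth_map [::]) // act_tableE.
have Nj : (j < N)%N by move: jN; rewrite mem_iota.
pose i0 := Ordinal iN; pose j0 := Ordinal Nj.
apply: (@veech_data_words R N p i0 (orbit_words c) _ _ n0 w0 st_lt tt_lt st_surj tt_surj).
- by move=> k /inN/stst/eqP.
- move=> k kn; apply: conj_tableP; rewrite rot_tableE -!repE ?st_lt //.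
  exact: rotc (inN _ kn).
- move=> k kn; apply: conj_tableP; rewrite shear_tableE -!repE ?tt_lt //.
  exact: shearc (inN _ kn).
- by move=> k /inN/lab/eqP.
- move=> k /andP[k0 kn]; apply: (@loops_separateP _ _ p _ (leq_ltn_trans (leq0n _) iN) loop0).
  by rewrite -repE //; apply: sep; rewrite mem_iota k0 add1n prednK.
- by rewrite -!singular_tableE /= -nth_table.
- by exists j0; rewrite -!singular_tableE /= -nth_table.
- move=> P P0 P1 P2; exact: (reachP (p := p) P0 P1 P2 tr).
- by [].
- by move=> i im; have /wP/andP[? /eqP] : i \in iota 0 (size (cusp_words c)) by rewrite mem_iota.
- exact: orb.
Qed.

Definition cycles_table (N : nat) (cs : seq (seq nat)) : seq nat :=
  [seq (cycles_fun cs k.+1).-1 | k <- iota 0 N].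

Definition cycles_tables (N : nat) (ch cv : seq (seq nat)) : tables :=
  let h := cycles_table N ch in let v := cycles_table N cv in
  Tables h (table_inv N h) v (table_inv N v).

Lemma table_perm_of_cycles N cs (H : disjoint_cycles N cs) :
  table (perm_of_cycles H) = cycles_table N cs.
Proof.
apply/esym/table_eq; first by rewrite size_map size_iota.
by move=> i; rewrite (nth_map 0%N) ?size_iota // nth_iota // permE.
Qed.

Lemma pair_table_cycles N ch cv (Hh : disjoint_cycles N ch) (Hv : disjoint_cycles N cv) :
  pair_table (perm_of_cycles Hh, perm_of_cycles Hv) = cycles_tables N ch cv.
Proof. by rewrite /pair_table /= !table_invE !table_perm_of_cycles. Qed.

(** The four entries of [mat_word], computed with integers instead of matrices. *)
Definition coords_word (w : seq bool) : (int * int) * (int * int) :=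
  foldr (fun b m => if b then ((m.1.1 + m.2.1, m.1.2 + m.2.2), m.2)
                    else ((- m.2.1, - m.2.2), m.1)) ((1, 0), (0, 1)) w.

Lemma mat_word_coords w : let m := coords_word w in
  mat_word w = mx2 m.1.1 m.1.2 m.2.1 m.2.2.
Proof.
elim: w => [|b w /= IH]; first by rewrite /= mx2_1.
by rewrite /= IH; case: b => /=; rewrite mulmx2; congr mx2; ring.
Qed.

Lemma moebius_word w : moebius (invmx (mat_word w)) inftyQ =
  proj_pt (coords_word w).2.2 (- (coords_word w).2.1).
Proof.
have := SL2Z_mat_word w; rewrite mat_word_coords => /SL2Z_mx2 h.
by rewrite invmx2 // moebius_infty !mxE.
Qed.

(** The representatives of the cusps are read off the bottom row of the inverse
    matrices. *)
Lemma certified_cyclesP (R : realType) N ch cv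
    (Hh : disjoint_cycles N ch) (Hv : disjoint_cycles N cv) c ws :
  certified N (cycles_tables N ch cv) c ws ->
  veech_data (square_tiled R (perm_of_cycles Hh) (perm_of_cycles Hv))
    (size (orbit_words c))
    [seq proj_pt (coords_word u).2.2 (- (coords_word u).2.1) | u <- cusp_words c] ws.
Proof.
rewrite -(pair_table_cycles Hh Hv) => /(certifiedP R erefl).
by rewrite (eq_map moebius_word).
Qed.

(** * The five surfaces *)

Section Certificates.

(** [T] and [S] are the shear and the rotation; [H] and [V] are steps to the right
    and upwards. *)
Local Notation T := true (only parsing).
Local Notation S := false (only parsing).
Local Notation H := true (only parsing).
Local Notation V := false (only parsing).

Definition mucube_certificate : certificate := Certificate
    [:: [::]; [:: T]; [:: T; T]; [:: S; T]; [:: T; T; T]; [:: S; T; T]; [::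
     T; S; T]; [:: T; S; T; T]; [:: T; T; S; T]]
    [:: (0, 0); (3, 0); (5, 0); (1, 0); (6, 0); (2, 0); (4, 0); (8, 0); (7,
     0)]%N
    [:: (1, 0); (2, 0); (4, 0); (6, 0); (0, 0); (7, 0); (8, 0); (5, 0); (3,
     0)]%N
    [:: [:: H; H; V; H; H; V]; [:: H; H; H; H]]
    0 5
    [:: [::]; [:: S; T; T; S]; [:: S; T; S]].

Definition muoctahedron_certificate : certificate := Certificate
    [:: [::]; [:: T]; [:: S]; [:: T; T]; [:: S; T]; [:: T; T; T]; [:: S; T;
     T]; [:: T; S; T]; [:: T; T; T; T]; [:: S; T; T; T]; [:: T; S; T; T];
     [:: T; T; S; T]; [:: S; T; S; T]; [:: S; T; T; T; T]; [:: T; S; T; T;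
     T]; [:: T; T; S; T; T]]
    [:: (2, 0); (4, 0); (0, 2); (6, 0); (1, 0); (9, 0); (3, 1); (12, 0);
     (13, 0); (5, 2); (11, 2); (10, 1); (7, 0); (8, 0); (15, 1); (14, 2)]%N
    [:: (1, 0); (3, 0); (0, 0); (5, 0); (7, 0); (8, 0); (10, 0); (11, 0);
     (9, 0); (14, 0); (15, 0); (4, 0); (2, 0); (13, 0); (12, 0); (6, 0)]%N
    [:: [:: H; H; V; H; H; V; H; H; V]; [:: H; H; H; H; H; V; H; H; H; H; H;
     V]]
    0 11
    [:: [::]; [:: S; T; T; T; T; T; S]; [:: S; T; T; S]; [:: S; T; T; T; T;
     T; T; T; S]].

Definition mutetrahedron_certificate : certificate := Certificate
    [:: [::]; [:: T]; [:: T; T]; [:: S; T; T]]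
    [:: (1, 2); (0, 1); (3, 0); (2, 1)]%N
    [:: (1, 0); (2, 0); (0, 0); (3, 0)]%N
    [:: [:: H; H; V; V]]
    2 6
    [:: [::]; [:: S; T; S]].

Definition octa4_certificate : certificate := Certificate
    [:: [::]; [:: T]; [:: S]; [:: S; T]]
    [:: (2, 0); (3, 0); (0, 0); (1, 0)]%N
    [:: (1, 0); (2, 0); (0, 0); (3, 0)]%N
    [:: [:: V; V; V]; [:: H; H; H]; [:: H; V; H; V; H; V]]
    0 8
    [:: [::]; [:: S; T; T; S]].

Definition truncated_octa8_certificate : certificate := Certificate
    [:: [::]; [:: T]; [:: T; T]; [:: S; T]; [:: T; T; T]; [:: S; T; T]; [::
     T; S; T]; [:: T; T; T; T]; [:: S; T; T; T]; [:: T; S; T; T]; [:: T; T;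
     S; T]; [:: S; T; S; T]; [:: S; T; T; T; T]; [:: T; S; T; T; T]; [:: T;
     S; T; T; T; T]]
    [:: (0, 0); (3, 0); (5, 0); (1, 0); (8, 0); (2, 0); (11, 0); (12, 0);
     (4, 0); (10, 0); (9, 0); (6, 0); (7, 0); (14, 0); (13, 0)]%N
    [:: (1, 0); (2, 0); (4, 0); (6, 0); (7, 0); (9, 0); (10, 0); (11, 0);
     (13, 0); (12, 0); (3, 0); (0, 0); (14, 0); (8, 0); (5, 0)]%N
    [:: [:: H; V; H; V; H; V]; [:: V; V; V; V; V; V]; [:: H; H; H; H; H; H]]
    0 10
    [:: [::]; [:: S; T; T; S; T; T; S; T; S]; [:: S; T; S]; [:: S; T; T; S;
     T; T; S; T; T; S; T; S]].


Lemma mucube_veech (R : realType) :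
  veech_data (mucube R) 9
    [:: inftyQ; Some (1 / 2); Some 1] [:: 4; 2; 3]%N.
Proof.
have cert : certified 24 (cycles_tables 24 (blocks 6 4) mucube_v)
    mucube_certificate [:: 4; 2; 3]%N by vm_compute.
have := certified_cyclesP R mucube_h_ok mucube_v_ok cert.
by congr veech_data; vm_compute.
Qed.

Lemma muoctahedron_veech (R : realType) :
  veech_data (muoctahedron R) 16
    [:: inftyQ; Some (1 / 5); Some (1 / 2); Some (1 / 7)] [:: 9; 1; 3; 3]%N.
Proof.
have cert : certified 72 (cycles_tables 72 (blocks 8 9) muoctahedron_v)
    muoctahedron_certificate [:: 9; 1; 3; 3]%N by vm_compute.
have := certified_cyclesP R muoctahedron_h_ok muoctahedron_v_ok cert.
by congr veech_data; vm_compute.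
Qed.

Lemma mutetrahedron_veech (R : realType) :
  veech_data (mutetrahedron R) 4
    [:: inftyQ; Some 1] [:: 3; 1]%N.
Proof.
have cert : certified 24 (cycles_tables 24 (blocks 4 6) mutetrahedron_v)
    mutetrahedron_certificate [:: 3; 1]%N by vm_compute.
have := certified_cyclesP R mutetrahedron_h_ok mutetrahedron_v_ok cert.
by congr veech_data; vm_compute.
Qed.

Lemma octa4_veech (R : realType) :
  veech_data (octa4 R) 4
    [:: inftyQ; Some (1 / 2)] [:: 3; 1]%N.
Proof.
have cert : certified 48 (cycles_tables 48 (blocks 16 3) octa4_v)
    octa4_certificate [:: 3; 1]%N by vm_compute.
have := certified_cyclesP R octa4_h_ok octa4_v_ok cert.
by congr veech_data; vm_compute.
Qed.

Lemma truncated_octa8_veech (R : realType) :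
  veech_data (truncated_octa8 R) 15
    [:: inftyQ; Some 3; Some 1; Some 4] [:: 6; 2; 3; 4]%N.
Proof.
have cert : certified 120 (cycles_tables 120 (blocks 20 6) truncated_octa8_v)
    truncated_octa8_certificate [:: 6; 2; 3; 4]%N by vm_compute.
have := certified_cyclesP R truncated_octa8_h_ok truncated_octa8_v_ok cert.
by congr veech_data; vm_compute.
Qed.

End Certificates.

Theorem theorem1p2 (R : realType) :
  veech_data (mucube R) 9
    [:: inftyQ; Some (1 / 2); Some 1] [:: 4; 2; 3]%N /\
  veech_data (muoctahedron R) 16
    [:: inftyQ; Some (1 / 5); Some (1 / 2); Some (1 / 7)] [:: 9; 1; 3; 3]%N /\
  veech_data (mutetrahedron R) 4
    [:: inftyQ; Some 1] [:: 3; 1]%N /\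
  veech_data (octa4 R) 4
    [:: inftyQ; Some (1 / 2)] [:: 3; 1]%N /\
  veech_data (truncated_octa8 R) 15
    [:: inftyQ; Some 3; Some 1; Some 4] [:: 6; 2; 3; 4]%N.
Proof.
split; first exact: mucube_veech.
split; first exact: muoctahedron_veech.
split; first exact: mutetrahedron_veech.
split; first exact: octa4_veech.
exact: truncated_octa8_veech.
Qed.
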